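(* Let $(\mathfrak{D},\mathfrak{I},\sigma)$ be a Dynkin triple with $\mathfrak{D}$ connected, $\sigma=1$ and $\mathfrak{I}^{\ge2}\ne\emptyset$. Then the condition ''the actions of $\sigma$ and of $-w_{0,\mathfrak{I}}$ on $\mathfrak{I}$ coincide'' holds precisely in the following cases: (1) $\mathfrak{D}$ is of type $B_n$ or $C_n$ ($n\ge2$) and $\mathfrak{I}^{\ge2}$ is of type $B_m$ or $C_m$ respectively for some $2\le m\le n$ (i.e. $\mathfrak{I}^{\ge2}$ is connected and contains the multi-laced vertices); (2) $\mathfrak{D}$ is of type $D_4$ or $G_2$ and $\mathfrak{D}=\mathfrak{I}^{\ge2}$; (3) $\mathfrak{D}$ is of type $D_n$ ($n\ge5$) and $\mathfrak{I}^{\ge2}$ is the unique sub-diagram of type $D_{2m}$ for some $2\le m\le n/2$ (connected, of even size, containing the two extremal vertices permuted by $\mathrm{Aut}(\mathfrak{D})$); (4) $\mathfrak{D}$ is of type $F_4$ and $\mathfrak{I}^{\ge2}$ is the unique sub-diagram of type $B_2\cong C_2$, $B_3$, $C_3$ or $F_4$; (5) $\mathfrak{D}$ is of type $E_6$ and $\mathfrak{I}^{\ge2}\cong D_4$; (6) $\mathfrak{D}$ is of type $E_7$ and $\mathfrak{I}^{\ge2}$ is of type $D_4$, $D_6$ or $E_7$; (7) $\mathfrak{D}$ is of type $E_8$ and $\mathfrak{I}^{\ge2}$ is of type $D_4$, $D_6$, $E_7$ or $E_8$.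
   Context: A Dynkin triple $(\mathfrak{D},\mathfrak{I},\sigma)$ consists of a Dynkin diagram $\mathfrak{D}$ (of a reduced root system, vertices = simple roots), a diagram automorphism $\sigma\in\mathrm{Aut}(\mathfrak{D})$ and a $\sigma$-stable sub-diagram $\mathfrak{I}\subset\mathfrak{D}$ (possibly $\mathfrak{I}=\mathfrak{D}$). $-w_{0,\mathfrak{I}}$ is the opposition involution of $\mathfrak{I}$ (the permutation $\alpha\mapsto-w_{0,\mathfrak{I}}\alpha$ of $\mathfrak{I}$, where $w_{0,\mathfrak{I}}$ is the longest element of the Weyl group generated by reflections in $\mathfrak{I}$). A vertex of $\mathfrak{I}$ is isolated if its connected component in $\mathfrak{I}$ is a single vertex; $\mathfrak{I}^{\ge2}$ is the union of the connected components of $\mathfrak{I}$ with at least two vertices. *)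

(* Defs.v *)
From mathcomp Require Import all_boot all_order all_algebra all_fingroup.

Set Implicit Arguments.
Unset Strict Implicit.
Unset Printing Implicit Defensive.

Import Order.TTheory GRing.Theory Num.Theory.
Local Open Scope ring_scope.

(* Reduced root systems in the sense of Bourbaki: the roots are a finite
   spanning family of distinct vectors of V, each with a coroot (a linear form)
   and a reflection b |-> b - <b, a^vee> a permuting the roots.
   The convention for the integers n(a, b) is Bourbaki's:
   cartan a b = <a, b^vee>. *)
Record root_system (R : realFieldType) (V : vectType R) := RootSystem {
  roots :> finType;
  root : roots -> V;
  coroot : roots -> 'Hom(V, R^o);
  cartan : roots -> roots -> int;
  reflection : roots -> {perm roots};
  root_inj : injective root;
  root_span : <<codom root>>%VS = fullv;
  coroot_root : forall a, coroot a (root a) = 2%:R;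
  cartanE : forall a b, coroot b (root a) = (cartan a b)%:~R;
  reflectionE : forall a b,
    root (reflection a b) = root b - coroot a (root b) *: root a;
  root_reduced : forall (a b : roots) (c : R),
    root b = c *: root a -> root b = root a \/ root b = - root a
}.

(* The root -a, since the reflection s_a sends a to -a. *)
Definition neg_root (R : realFieldType) (V : vectType R) (Phi : root_system V)
    (a : Phi) : Phi :=
  reflection a a.

Definition is_base (R : realFieldType) (V : vectType R) (Phi : root_system V)
    (D : {set Phi}) : Prop :=
  free [seq root a | a in D] /\
  forall a : Phi, exists c : Phi -> nat,
    root a = \sum_(b in D) root b *+ c b \/
    root a = - \sum_(b in D) root b *+ c b.

(* A (sub-)diagram is a set of simple roots: the number and the orientation of
   the edges between two vertices are determined by their Cartan integers. *)
Definition adjacent (R : realFieldType) (V : vectType R) (Phi : root_system V)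
    (J : {set Phi}) : rel Phi :=
  [rel a b | [&& a \in J, b \in J, a != b & cartan a b != 0]].

Definition component (R : realFieldType) (V : vectType R) (Phi : root_system V)
    (J : {set Phi}) (a : Phi) : {set Phi} :=
  [set b in J | connect (adjacent J) a b].

Definition connected (R : realFieldType) (V : vectType R) (Phi : root_system V)
    (J : {set Phi}) : Prop :=
  J != set0 /\ {in J &, forall a b, connect (adjacent J) a b}.

Definition nonisolated (R : realFieldType) (V : vectType R)
    (Phi : root_system V) (J : {set Phi}) : {set Phi} :=
  \bigcup_(a in J | (2 <= #|component J a|)%N) component J a.

Definition multilaced (R : realFieldType) (V : vectType R)
    (Phi : root_system V) (D : {set Phi}) : {set Phi} :=
  [set a in D | [exists b in D, (a != b) && (1 < cartan a b * cartan b a)]].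

Definition diagram_aut (R : realFieldType) (V : vectType R)
    (Phi : root_system V) (D : {set Phi}) : {set {perm Phi}} :=
  [set s | perm_on D s &
     [forall a in D, forall b in D, cartan (s a) (s b) == cartan a b]].

Definition moved_vertices (R : realFieldType) (V : vectType R)
    (Phi : root_system V) (D : {set Phi}) : {set Phi} :=
  [set a in D | [exists s in diagram_aut D, s a != a]].

Record dynkin_triple (R : realFieldType) (V : vectType R)
    (Phi : root_system V) (D I : {set Phi}) (s : {perm Phi}) : Prop := {
  triple_base : is_base D;
  triple_sub : I \subset D;
  triple_aut : s \in diagram_aut D;
  triple_stable : s @: I = I
}.

(* The Weyl group generated by the reflections in I acts faithfully on the
   roots, as these span V; it is realized as a group of permutations. *)
Definition weyl (R : realFieldType) (V : vectType R) (Phi : root_system V)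
    (I : {set Phi}) : {set {perm Phi}} :=
  <<[set reflection a | a in I]>>%g.

Definition is_word (R : realFieldType) (V : vectType R) (Phi : root_system V)
    (I : {set Phi}) (w : {perm Phi}) (k : nat) : bool :=
  [exists t : k.-tuple Phi,
     all (mem I) t && (w == \prod_(a <- t) reflection a)%g].

Lemma weyl_word (R : realFieldType) (V : vectType R) (Phi : root_system V)
    (I : {set Phi}) (w : {perm Phi}) :
  exists k, (w \in weyl I) ==> is_word I w k.
Proof.
case: (boolP (w \in weyl I)) => [|_]; last by exists 0%N.
case/gen_prodgP=> k [c Ic ->]; exists k => /=.
have {}Ic i : exists a, (a \in I) && (c i == reflection a).
  by case/imsetP: (Ic i) => a Ia ->; exists a; rewrite Ia eqxx.
apply/existsP; exists [tuple xchoose (Ic i) | i < k].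
apply/andP; split.
  by apply/all_tnthP=> i; rewrite tnth_mktuple; case/andP: (xchooseP (Ic i)).
apply/eqP; rewrite big_tuple; apply: eq_bigr => i _.
by rewrite tnth_mktuple; case/andP: (xchooseP (Ic i)) => _ /eqP.
Qed.

(* Meaningful for w in weyl I only. *)
Definition weyl_length (R : realFieldType) (V : vectType R)
    (Phi : root_system V) (I : {set Phi}) (w : {perm Phi}) : nat :=
  ex_minn (weyl_word I w).

Definition longest (R : realFieldType) (V : vectType R) (Phi : root_system V)
    (I : {set Phi}) : {perm Phi} :=
  [arg max_(w > 1%g in weyl I) weyl_length I w]%N.

Definition opposition (R : realFieldType) (V : vectType R)
    (Phi : root_system V) (I : {set Phi}) (a : Phi) : Phi :=
  neg_root (longest I a).

(* DynkinB n and DynkinC n are used for n >= 2, DynkinD n for n >= 4 and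
   DynkinE n for 6 <= n <= 8. *)
Inductive dynkin_type :=
  | DynkinB of nat | DynkinC of nat | DynkinD of nat | DynkinE of nat
  | DynkinF4 | DynkinG2.

Definition rank (X : dynkin_type) : nat :=
  match X with
  | DynkinB n | DynkinC n | DynkinD n | DynkinE n => n
  | DynkinF4 => 4
  | DynkinG2 => 2
  end.

Definition simply_laced (e : rel nat) (i j : nat) : int :=
  if i == j then 2 else if e i j || e j i then -1 else 0.

Definition chain : rel nat := fun i j => i.+1 == j.

(* The Cartan matrices n(a_i, a_j), with Bourbaki's numbering shifted to start
   at 0. *)
Definition cartan_matrix (X : dynkin_type) (i j : nat) : int :=
  match X with
  | DynkinB n =>
      if (i.+2 == n) && (j.+1 == n) then -2 else simply_laced chain i j
  | DynkinC n =>
      if (i.+1 == n) && (j.+2 == n) then -2 else simply_laced chain i j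
  | DynkinD n =>
      simply_laced (fun k l => (chain k l && (l.+1 < n)%N) ||
                               ((k.+3 == n) && (l.+1 == n))) i j
  | DynkinE n =>
      simply_laced (fun k l => ((k, l) \in [:: (0, 2); (1, 3)]%N) ||
                               (chain k l && (2 <= k)%N)) i j
  | DynkinF4 =>
      if (i == 1%N) && (j == 2%N) then -2 else simply_laced chain i j
  | DynkinG2 =>
      if (i == 1%N) && (j == 0%N) then -3 else simply_laced chain i j
  end.

Definition of_type (R : realFieldType) (V : vectType R) (Phi : root_system V)
    (X : dynkin_type) (J : {set Phi}) : Prop :=
  exists f : 'I_(rank X) -> Phi,
    [/\ injective f, J = [set f i | i : 'I_(rank X)] &
        forall i j, cartan (f i) (f j) = cartan_matrix X i j].

Definition is_unique_subdiagram (R : realFieldType) (V : vectType R)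
    (Phi : root_system V) (D : {set Phi}) (X : dynkin_type)
    (J : {set Phi}) : Prop :=
  [/\ J \subset D, of_type X J &
      forall K : {set Phi}, K \subset D -> of_type X K -> K = J].

(* Main.v *)
From HB Require Import structures.
From mathcomp Require Import all_boot all_order all_algebra all_fingroup.
From mathcomp Require Import zify ring.
Require Import Defs.

Set Implicit Arguments.
Unset Strict Implicit.
Unset Printing Implicit Defensive.

Import Order.TTheory GRing.Theory Num.Theory.
Local Open Scope ring_scope.

(* The opposition involution is trivial on I iff some w in W_I acts as -1 on I.
   Positive cases: -1 is a product of reflections in pairwise orthogonal roots
   (types B, C, D_2m), or a power of a Coxeter element (E_7, E_8, F_4, G_2).
   Negative cases: W_I acts trivially on weights modulo roots, and this quotient
   is not killed by 2 for A_n (n >= 2), D_n (n odd) and E_6.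
   Hence a component of I with at least two vertices on which -1 is realized
   contains a branch vertex or a multiple edge.  Adding the remaining vertices of
   D to it one at a time, positive definiteness forbids every affine subdiagram
   and so determines the type of D at each step.  As D has at most one branch
   vertex or multiple edge, the component is unique. *)

(** * Root systems and the longest element *)

Section RootSystem.
Variables (R : realFieldType) (V : vectType R) (Phi : root_system V).
Implicit Types (a b r : Phi) (I J K : {set Phi}) (w : {perm Phi}).

Lemma cartan_diag a : cartan a a = 2.
Proof.
apply/eqP; rewrite -(eqr_int R) -cartanE coroot_root; exact/eqP.
Qed.

Lemma root_reflection a b :
  root (reflection a b) = root b - (cartan b a)%:~R *: root a.
Proof. by rewrite reflectionE cartanE. Qed.

Lemma root_neg a : root (neg_root a) = - root a.
Proof.
by rewrite root_reflection cartan_diag scaler_nat mulr2n opprD addNKr.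
Qed.

Lemma neg_rootK : involutive (@neg_root R V Phi).
Proof. by move=> a; apply: root_inj; rewrite !root_neg opprK. Qed.

Lemma root_neq0 a : root a != 0.
Proof.
apply/eqP => a0; have := coroot_root a; rewrite a0 linear0 => /eqP.
by rewrite eq_sym (pnatr_eq0 R 2).
Qed.

Lemma cartan_reflection b a c :
  cartan (reflection a b) c = cartan b c - cartan b a * cartan a c.
Proof.
apply/eqP; rewrite -(eqr_int R) rmorphB rmorphM -!cartanE root_reflection.
by rewrite linearB linearZ /= !cartanE.
Qed.

Lemma reflectionK a : involutive (reflection a).
Proof.
move=> b; apply: root_inj; rewrite !root_reflection cartan_reflection.
rewrite cartan_diag (_ : _ - _ * 2 = - cartan b a :> int); last by ring.
by rewrite rmorphN scaleNr opprK subrK.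
Qed.

Lemma reflection_mulK a : (reflection a * reflection a = 1)%g.
Proof. by apply/permP => b; rewrite permM perm1 reflectionK. Qed.

Lemma reflection_neg a b : reflection a (neg_root b) = neg_root (reflection a b).
Proof.
apply: root_inj; rewrite reflectionE !root_neg reflectionE linearN /=.
by rewrite scaleNr opprK opprB addrC.
Qed.

Definition root_weight a : int := \sum_b cartan b a ^+ 2.

Lemma root_weight_gt0 a : 0 < root_weight a.
Proof.
rewrite /root_weight (bigD1 a) //= cartan_diag ltr_pwDl //.
by apply: sumr_ge0 => b _; exact: sqr_ge0.
Qed.

Lemma sum_cartan_root a :
  2%:R *: (\sum_b (cartan b a)%:~R *: root b) = (root_weight a)%:~R *: root a.
Proof.
rewrite scaler_nat mulr2n {1}(reindex_inj (@perm_inj _ (reflection a))) /=.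
rewrite -big_split /root_weight rmorph_sum scaler_suml; apply: eq_bigr => b _.
rewrite cartan_reflection cartan_diag (_ : _ - _ * 2 = - cartan b a :> int); last by ring.
rewrite root_reflection rmorphN scaleNr scalerBr opprB scalerA rmorphXn.
by rewrite /= expr2 subrK.
Qed.

Lemma sum_cartan_cartan a c :
  2 * (\sum_b cartan b a * cartan b c) = root_weight a * cartan a c.
Proof.
apply/eqP; rewrite -(eqr_int R) !rmorphM rmorph_sum /=; apply/eqP.
have H : 2%:R * (coroot c (\sum_b (cartan b a)%:~R *: root b)) =
    (root_weight a)%:~R * (cartan a c)%:~R :> R.
  by rewrite -cartanE -!(linearZ_LR (coroot c)) sum_cartan_root.
rewrite -[RHS]H linear_sum; congr (_ * _).
by apply: eq_bigr => b _; rewrite linearZ /= cartanE rmorphM.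
Qed.

Lemma root_weight_sym a c :
  root_weight a * cartan a c = root_weight c * cartan c a.
Proof.
rewrite -!sum_cartan_cartan; congr (_ * _).
by apply: eq_bigr => b _; rewrite mulrC.
Qed.

Lemma cartan_eq0 a c : (cartan a c == 0) = (cartan c a == 0).
Proof.
have /(congr1 (fun x => x == 0)) := root_weight_sym a c.
by rewrite !mulf_eq0 !(gt_eqF (root_weight_gt0 _)).
Qed.

Lemma free_comb0 (D : {set Phi}) (k : Phi -> R) :
  free [seq root a | a in D] -> \sum_(a in D) k a *: root a = 0 ->
  {in D, forall a, k a = 0}.
Proof.
move=> /freeP fr; rewrite big_enum_val /= => k0 a aD.
rewrite -(enum_rankK_in aD aD); move: (enum_rank_in aD a); apply: fr.
rewrite -[RHS]k0; apply: eq_bigr => i _; congr (_ *: _).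
by rewrite (enum_val_nth a) /= (nth_map a) // -cardE.
Qed.

(* The quadratic form sum_b <b, y>^2 on combinations y of simple coroots is
   positive definite; only the case of a non-negative combination is needed. *)
Lemma no_semipositive (D : {set Phi}) (c : Phi -> int) :
  free [seq root a | a in D] ->
  (forall a, a \notin D -> c a = 0) ->
  (forall a, a \in D -> c a * (\sum_(b in D) c b * cartan a b) <= 0) ->
  forall a, c a = 0.
Proof.
move=> frD c0 rows.
pose y b := \sum_(a in D) c a * cartan b a.
have ssq : 2 * \sum_b y b ^+ 2 = \sum_(a in D) root_weight a * (c a * y a).
  rewrite [in RHS](eq_bigr (fun a => \sum_(a' in D) c a * c a' *
     (2 * \sum_b cartan b a * cartan b a'))); last first.
    move=> a _; rewrite mulrA mulr_sumr; apply: eq_bigr => a' _.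
    by rewrite sum_cartan_cartan; ring.
  under eq_bigr => a _ do under eq_bigr => a' _ do rewrite mulrCA mulr_sumr.
  under eq_bigr => a _ do rewrite -mulr_sumr.
  rewrite -mulr_sumr; congr (_ * _).
  under [in RHS]eq_bigr => a _ do rewrite exchange_big /=.
  rewrite exchange_big /=; apply: eq_bigr => b _.
  rewrite expr2 /y mulr_suml; apply: eq_bigr => a _.
  by rewrite mulr_sumr; apply: eq_bigr => a' _; ring.
have le0 : 2 * \sum_b y b ^+ 2 <= 0.
  rewrite ssq; apply: sumr_le0 => a aD.
  by rewrite pmulr_rle0 ?root_weight_gt0 // rows.
have y0 b : y b = 0.
  have : \sum_b y b ^+ 2 == 0.
    rewrite eq_le sumr_ge0 ?andbT; last by move=> *; exact: sqr_ge0.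
    by move: le0; rewrite pmulr_rle0.
  rewrite psumr_eq0 => [/allP/(_ b)|*]; last exact: sqr_ge0.
  by rewrite mem_index_enum => /(_ isT); rewrite sqrf_eq0 => /eqP.
have comb0 : \sum_(a in D) (c a * root_weight a)%:~R *: root a = 0 :> V.
  transitivity (\sum_(a in D) (c a)%:~R *:
     (2%:R *: (\sum_b (cartan b a)%:~R *: root b))).
    by apply: eq_bigr => a _; rewrite sum_cartan_root scalerA -rmorphM.
  transitivity (2%:R *: \sum_b (y b)%:~R *: root b).
    under eq_bigr => a _ do rewrite scalerA mulrC -scalerA.
    rewrite -scaler_sumr; congr (_ *: _).
    under eq_bigr => a _ do rewrite scaler_sumr.
    rewrite exchange_big; apply: eq_bigr => b _.
    rewrite /y rmorph_sum scaler_suml; apply: eq_bigr => a _.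
    by rewrite scalerA rmorphM.
  by rewrite big1 ?scaler0 // => b _; rewrite y0 scale0r.
move=> a; case: (boolP (a \in D)) => [aD|]; last exact: c0.
have /eqP := free_comb0 frD comb0 aD.
by rewrite intr_eq0 mulf_eq0 (gt_eqF (root_weight_gt0 a)) orbF => /eqP.
Qed.

Lemma reflection_weyl I a : a \in I -> reflection a \in weyl I.
Proof. by move=> aI; apply/mem_gen/imset_f. Qed.

Lemma prod_weyl I (t : seq Phi) :
  all (mem I) t -> (\prod_(a <- t) reflection a)%g \in weyl I.
Proof.
move=> /allP tI; rewrite big_seq.
by apply: group_prod => a /tI aI; exact: reflection_weyl.
Qed.

Lemma weyl_lengthP I w : w \in weyl I ->
  exists t : seq Phi, [/\ all (mem I) t, size t = weyl_length I w
    & w = (\prod_(a <- t) reflection a)%g].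
Proof.
move=> wI; rewrite /weyl_length; case: ex_minnP => k; rewrite wI => /=.
by case/existsP => t /andP[tI /eqP ->] _; exists t; rewrite size_tuple.
Qed.

Lemma weyl_length_prod I (t : seq Phi) : all (mem I) t ->
  (weyl_length I (\prod_(a <- t) reflection a)%g <= size t)%N.
Proof.
move=> tI; rewrite /weyl_length; case: ex_minnP => k _; apply.
rewrite prod_weyl //=; apply/existsP; exists (in_tuple t).
by rewrite tI eqxx.
Qed.

Lemma weyl_ind I (P : {perm Phi} -> Prop) :
  P 1%g -> (forall w a, w \in weyl I -> a \in I -> P w -> P (w * reflection a)%g) ->
  forall w, w \in weyl I -> P w.
Proof.
move=> P1 PM w /weyl_lengthP[t [+ _ ->]].
elim/last_ind: t => [|t a IHt]; first by rewrite big_nil.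
rewrite all_rcons => /andP[aI tI]; rewrite big_rcons; apply: PM => //; first exact: prod_weyl.
exact: IHt.
Qed.

Lemma weylS I J : I \subset J -> weyl I \subset weyl J.
Proof. by move=> IJ; apply/genS/imsetS. Qed.

Lemma weyl_linear I w : w \in weyl I ->
  exists L : 'End(V), forall b, root (w b) = L (root b).
Proof.
move: w; apply: weyl_ind => [|w a _ _ [L HL]].
  by exists \1%VF => b; rewrite perm1 lfunE.
have lin_refl : linear (fun v : V => v - coroot a v *: root a).
  move=> k u v; rewrite linearP scalerBr scalerDl scalerA opprD /= addrACA.
  by rewrite -scalerA.
pose rl := GRing.isLinear.Build _ _ _ _ _ lin_refl.
pose rL : {linear V -> V} := HB.pack (fun v : V => v - coroot a v *: root a) rl.
exists (linfun rL \o L)%VF => b.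
by rewrite permM comp_lfunE lfunE /= -HL reflectionE.
Qed.

Lemma cartan_reflection2 a b c :
  cartan (reflection a b) (reflection a c) = cartan b c.
Proof.
pose d := root_weight c; pose d' := root_weight (reflection a c).
pose h x := d' * (cartan x c - cartan x a * cartan a c)
  - d * cartan x (reflection a c).
have h_orth q : \sum_x h x * cartan x q = 0.
  have E p := sum_cartan_cartan p q.
  have : 2 * (\sum_x h x * cartan x q) = 0.
    transitivity (d' * (2 * \sum_x cartan x c * cartan x q)
      - d' * cartan a c * (2 * \sum_x cartan x a * cartan x q)
      - d * (2 * \sum_x cartan x (reflection a c) * cartan x q)).
      rewrite !mulr_sumr -!sumrB; apply: eq_bigr => x _; rewrite /h; ring.
    rewrite !E cartan_reflection -/d -/d'.
    transitivity (d' * cartan a q * (d * cartan c a - root_weight a * cartan a c)).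
      by ring.
    by rewrite root_weight_sym /d subrr mulr0.
  by lia.
have h0 x : h x = 0.
  have : \sum_x h x ^+ 2 == 0.
    apply/eqP; transitivity (d' * (\sum_x h x * cartan x c)
        - d' * cartan a c * (\sum_x h x * cartan x a)
        - d * (\sum_x h x * cartan x (reflection a c))).
      by rewrite !mulr_sumr -!sumrB; apply: eq_bigr => y _; rewrite /h; ring.
    by rewrite !h_orth !mulr0 !subr0.
  rewrite psumr_eq0 => [/allP/(_ x)|*]; last exact: sqr_ge0.
  by rewrite mem_index_enum => /(_ isT); rewrite sqrf_eq0 => /eqP.
have dd : d' = d.
  have := h0 (reflection a c).
  by rewrite /h -cartan_reflection reflectionK !cartan_diag; lia.
have := h0 (reflection a b); rewrite /h dd -cartan_reflection reflectionK -mulrBr.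
move/eqP; rewrite mulf_eq0 (gt_eqF (root_weight_gt0 c)) subr_eq0.
by move=> /eqP.
Qed.

Lemma cartan_weyl I w b c : w \in weyl I -> cartan (w b) (w c) = cartan b c.
Proof.
move=> wI; elim/weyl_ind: wI b c => [|{}w a _ _ IHw] b c; first by rewrite !perm1.
by rewrite !permM cartan_reflection2.
Qed.

Lemma reflection_weyl_conj I w b : w \in weyl I ->
  (reflection b * w = w * reflection (w b))%g.
Proof.
move=> wI; apply/permP => c; rewrite !permM; apply: root_inj.
have [L HL] := weyl_linear wI.
rewrite HL root_reflection linearB linearZ /= -!HL root_reflection.
by rewrite (cartan_weyl _ _ wI).
Qed.

Lemma weyl_neg I w b : w \in weyl I -> w (neg_root b) = neg_root (w b).
Proof.
move=> wI; have [L HL] := weyl_linear wI; apply: root_inj.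
by rewrite root_neg !HL root_neg linearN.
Qed.

Section Base.
Variables (D : {set Phi}) (baseD : is_base D).

Let frD : free [seq root a | a in D] := proj1 baseD.

Definition int_comb (z : Phi -> int) : V := \sum_(b in D) (z b)%:~R *: root b.

Lemma int_comb_inj z z' : int_comb z = int_comb z' -> {in D, z =1 z'}.
Proof.
move=> /eqP; rewrite -subr_eq0 -sumrB => /eqP zz' b bD.
apply/eqP; rewrite -(eqr_int R) -subr_eq0; apply/eqP.
apply: (free_comb0 (k := fun b => (z b)%:~R - (z' b)%:~R) frD _ bD).
by rewrite -[RHS]zz'; apply: eq_bigr => x _; rewrite scalerBl.
Qed.

Definition positive a : Prop :=
  exists2 z : Phi -> int, root a = int_comb z & forall b, 0 <= z b.

Lemma positive_or a : positive a \/ positive (neg_root a).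
Proof.
case: (proj2 baseD a) => c [] ac; [left|right]; exists (fun b => (c b)%:Z) => //;
  by rewrite ?root_neg ac ?opprK /int_comb; apply: eq_bigr => b _;
     rewrite -pmulrn scaler_nat.
Qed.

Lemma int_combN z : int_comb (fun b => - z b) = - int_comb z.
Proof.
by rewrite -sumrN; apply: eq_bigr => b _; rewrite rmorphN scaleNr.
Qed.

Lemma positiveN a : positive a -> positive (neg_root a) -> False.
Proof.
case=> z az z0 [z' az' z'0]; have := az'; rewrite root_neg az -int_combN.
move=> /int_comb_inj zz'; have := root_neq0 a; rewrite az /int_comb big1 ?eqxx //.
move=> b bD; have -> : z b = 0 by have := zz' b bD; have := z0 b; have := z'0 b; lia.
exact: scale0r.
Qed.

Lemma int_combD1 z a k : a \in D ->
  int_comb (fun b => z b + (b == a)%:Z * k) = int_comb z + k%:~R *: root a.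
Proof.
move=> aD; rewrite /int_comb.
under eq_bigr do rewrite rmorphD scalerDl.
rewrite big_split /=; congr (_ + _).
rewrite (bigD1 a) //= eqxx mul1r big1 ?addr0 // => b /andP[_ /negPf ->].
by rewrite mul0r scale0r.
Qed.

Lemma root_int_comb a : a \in D -> root a = int_comb (fun b => (b == a)%:Z).
Proof.
move=> aD; rewrite -[LHS]scale1r -[LHS]add0r.
rewrite (_ : 0 = int_comb (fun=> 0)); last by rewrite /int_comb big1 // => *; rewrite scale0r.
have := int_combD1 (fun=> 0) 1 aD; rewrite -[1%:~R]/(1 : R) => <-.
by apply: eq_bigr => b _; rewrite add0r mulr1.
Qed.

Lemma positive_base a : a \in D -> positive a.
Proof. by move=> /root_int_comb aE; eexists; first exact: aE. Qed.

Lemma coord_pos_positive a z b : root a = int_comb z -> b \in D -> 0 < z b ->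
  positive a.
Proof.
move=> az bD zb; case: (positive_or a) => // -[z' az' z'0].
have /int_comb_inj/(_ b bD) : int_comb (fun x => - z x) = int_comb z'.
  by rewrite int_combN -az -root_neg.
by have := z'0 b; lia.
Qed.

Lemma cartan_base_le0 a b : a \in D -> b \in D -> a != b -> cartan a b <= 0.
Proof.
move=> aD bD ab; rewrite leNgt; apply/negP => n0.
pose z x := (x == a)%:Z + (x == b)%:Z * - cartan a b.
have rz : root (reflection b a) = int_comb z.
  by rewrite int_combD1 // -root_int_comb // root_reflection rmorphN scaleNr.
have p1 : positive (reflection b a).
  by apply: (coord_pos_positive rz aD); rewrite /z eqxx (negPf ab) mul0r.
apply: (positiveN p1).
apply: (@coord_pos_positive _ (fun x => - z x) b) => //.
  by rewrite root_neg rz int_combN.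
by rewrite /z eqxx eq_sym (negPf ab) mul1r; lia.
Qed.

Lemma positive_reflection a b : a \in D -> positive b -> b != a ->
  positive (reflection a b).
Proof.
move=> aD [z bz z0] ba.
case: (pickP [pred x | [&& x \in D, x != a & 0 < z x]]) => [x /and3P[xD xa zx]|z0'].
  apply: (@coord_pos_positive _ (fun y => z y + (y == a)%:Z * - cartan b a) x) => //.
    by rewrite int_combD1 // -bz root_reflection rmorphN scaleNr.
  by rewrite (negPf xa) mul0r addr0.
have bE : root b = (z a)%:~R *: root a.
  rewrite bz /int_comb (bigD1 a) //= big1 ?addr0 // => x /andP[xD xa].
  have -> : z x = 0 by have := z0' x; rewrite /= xD xa /=; have := z0 x; lia.
  exact: scale0r.
case: (root_reduced bE) => [/root_inj/eqP|bN]; first by rewrite (negPf ba).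
have bNa : b = neg_root a by apply: root_inj; rewrite root_neg.
by case: (positiveN (positive_base aD)); rewrite -bNa; exists z.
Qed.

Section Parabolic.
Variables (I : {set Phi}) (ID : I \subset D).

Lemma exchange (t : seq Phi) b (w := (\prod_(a <- t) reflection a)%g) :
  all (mem I) t -> b \in I -> positive (neg_root (w b)) ->
  exists t' : seq Phi, [/\ all (mem I) t', (size t').+1 = size t
    & (reflection b * w)%g = (\prod_(a <- t') reflection a)%g].
Proof.
rewrite {}/w => tI bI; elim/last_ind: t tI => [_|t a IHt].
  rewrite big_nil perm1 => /(positiveN (positive_base (subsetP ID b bI))) //.
rewrite all_rcons big_rcons /= => /andP[aI tI] negw.
set u := (\prod_(i <- t) reflection i)%g in IHt negw *.
have uI : u \in weyl I by exact: prod_weyl.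
case: (positive_or (u b)) => [pos|/(IHt tI)[t' [t'I st' t'E]]]; last first.
  exists (rcons t' a); split; first by rewrite all_rcons /= aI.
    by rewrite !size_rcons st'.
  by rewrite big_rcons mulgA t'E.
have [uba|uba] := eqVneq (u b) a.
  exists t; split=> //; first by rewrite size_rcons.
  by rewrite mulgA (reflection_weyl_conj _ uI) uba -mulgA reflection_mulK mulg1.
case: (@positiveN (reflection a (u b))).
  exact: positive_reflection (subsetP ID a aI) pos uba.
by rewrite -permM.
Qed.

Lemma weyl_length_negative w b : w \in weyl I -> b \in I ->
  positive (neg_root (w b)) ->
  (weyl_length I (reflection b * w)%g < weyl_length I w)%N.
Proof.
move=> /weyl_lengthP[t [tI <- ->]] bI /(exchange tI bI)[t' [t'I <- ->]].
exact: weyl_length_prod.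
Qed.

Lemma weyl_length_positive w b : w \in weyl I -> b \in I ->
  positive (w b) ->
  (weyl_length I w < weyl_length I (reflection b * w)%g)%N.
Proof.
move=> wI bI wb.
have := @weyl_length_negative (reflection b * w)%g b.
rewrite mulgA reflection_mulK mul1g; apply=> //.
  by rewrite groupM // reflection_weyl.
by rewrite permM -/(neg_root b) (weyl_neg _ wI) neg_rootK.
Qed.

Lemma weyl_positive_eq1 w : w \in weyl I ->
  (forall b, b \in I -> positive (w b)) -> w = 1%g.
Proof.
move=> wI wpos; have [t [tI st wE]] := weyl_lengthP wI.
case: t tI st wE => [|b t] /=; first by rewrite big_nil.
case/andP=> bI tI st wE.
have := weyl_length_positive wI bI (wpos b bI).
have -> : (reflection b * w = \prod_(a <- t) reflection a)%g.
  by rewrite wE big_cons mulgA reflection_mulK mul1g.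
by have := weyl_length_prod tI; rewrite -st; lia.
Qed.

Definition has_neg : Prop :=
  exists2 w, w \in weyl I & forall a, a \in I -> w a = neg_root a.

Lemma opposition_trivial :
  {in I, forall a, a = opposition I a} <-> has_neg.
Proof.
have lI : longest I \in weyl I.
  by rewrite /longest; case: arg_maxnP => //; exact: group1.
have lmax w : w \in weyl I -> (weyl_length I w <= weyl_length I (longest I))%N.
  rewrite /longest; case: arg_maxnP => [|w' _ wmax]; first exact: group1.
  exact: wmax.
have lneg b : b \in I -> positive (neg_root (longest I b)).
  move=> bI; case: (positive_or (longest I b)) => // pos.
  have := weyl_length_positive lI bI pos.
  by rewrite ltnNge lmax // groupM // reflection_weyl.
split=> [opp|[w wI wneg] a aI].
  exists (longest I) => // a aI; rewrite {2}(opp a aI) /opposition.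
  by rewrite neg_rootK.
have wl1 : (w * longest I = 1)%g.
  apply: weyl_positive_eq1; first by rewrite groupM.
  by move=> b bI; rewrite permM wneg // (weyl_neg _ lI); exact: lneg.
by rewrite /opposition -(weyl_neg _ lI) -wneg // -permM wl1 perm1.
Qed.

End Parabolic.
End Base.
End RootSystem.

Section Criteria.
Variables (R : realFieldType) (V : vectType R) (Phi : root_system V).
Implicit Types (a b r : Phi) (I J K D : {set Phi}) (w : {perm Phi}).

Lemma coroot_int_comb D (z : Phi -> int) a :
  coroot a (int_comb D z) = (\sum_(b in D) z b * cartan b a)%:~R.
Proof.
rewrite /int_comb linear_sum rmorph_sum; apply: eq_bigr => b _.
by rewrite linearZ /= cartanE rmorphM.
Qed.

(* On the lattice spanned by the simple roots in I, the Weyl group acts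
   trivially on weights modulo roots, so -1 can belong to it only if twice
   every weight x / N is a combination of roots. *)
Lemma has_neg_weight D I (x : Phi -> int) (N : int) :
  is_base D -> I \subset D -> has_neg I -> (forall i, i \notin I -> x i = 0) ->
  (forall j, j \in I -> (N %| \sum_(i in I) x i * cartan i j)%Z) ->
  forall i, (N %| 2 * x i)%Z.
Proof.
move=> baseD ID [w wI wneg] xI xN i.
have {}xN j : j \in I -> (N %| \sum_(i in D) x i * cartan i j)%Z.
  move=> jI; rewrite (big_setID I) /= (setIidPr ID) [X in _ + X]big1 ?addr0 ?xN //.
  by move=> k /setDP[_ /xI ->]; rewrite mul0r.
have [i_I|/xI ->] := boolP (i \in I); last by rewrite mulr0 dvdz0.
have iD := subsetP ID i i_I.
suff [z] : exists z, \sum_(b in D) (x b)%:~R *: root (w b) =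
    int_comb D (fun b => x b + N * z b).
  rewrite (_ : \sum_(b in D) _ = int_comb D (fun b => - x b)); last first.
    apply: eq_bigr => b _; have [bI|/xI ->] := boolP (b \in I); last by rewrite !scale0r.
    by rewrite wneg // root_neg rmorphN scaleNr scalerN.
  by move=> /(int_comb_inj baseD)/(_ i iD) xz; apply/dvdzP; exists (- z i); lia.
elim/weyl_ind: wI {wneg} => [|{}w a _ aI [z wz]].
  by exists (fun=> 0); apply: eq_bigr => b _; rewrite perm1 mulr0 addr0.
have /dvdzP[q xq] := xN a aI.
exists (fun b => z b + (b == a)%:Z * - (q + \sum_(b in D) z b * cartan b a)).
have -> : \sum_(b in D) (x b)%:~R *: root ((w * reflection a)%g b) =
   int_comb D (fun b => x b + N * z b) -
     coroot a (int_comb D (fun b => x b + N * z b)) *: root a.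
  rewrite -wz linear_sum /= scaler_suml -sumrB; apply: eq_bigr => b _.
  by rewrite permM reflectionE [coroot a (_ *: _)]linearZ scalerBr; congr (_ - _); exact: scalerA.
rewrite coroot_int_comb -scaleNr -rmorphN -(int_combD1 _ _ (subsetP ID a aI)).
apply: eq_bigr => b _; congr (_%:~R *: _).
have -> : \sum_(b in D) (x b + N * z b) * cartan b a =
    q * N + N * (\sum_(b in D) z b * cartan b a).
  by rewrite -xq mulr_sumr -big_split; apply: eq_bigr => c _ /=; ring.
by ring.
Qed.

Lemma has_neg0 : has_neg (set0 : {set Phi}).
Proof. by exists 1%g => [|a]; rewrite ?group1 ?inE. Qed.

Lemma has_neg_setU1 J b r (z : Phi -> int) :
  has_neg J -> reflection r \in weyl (b |: J) ->
  (forall a, a \in J -> cartan a r = 0) ->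
  root r = \sum_(a in b |: J) (z a)%:~R *: root a -> z b != 0 -> has_neg (b |: J).
Proof.
move=> [w wJ wneg] rK rJ rE zb.
have [bJ|bJ] := boolP (b \in J).
  by rewrite (setUidPr _) ?sub1set //; exists w.
have wK : w \in weyl (b |: J) by apply: subsetP wJ; apply: weylS; exact: subsetUr.
have wr : w r = r.
  elim/weyl_ind: wJ {wneg wK} => [|{}w a _ aJ IHw]; first by rewrite perm1.
  apply: root_inj; rewrite permM IHw root_reflection.
  have /eqP := rJ a aJ; rewrite cartan_eq0 => /eqP ->.
  by rewrite scale0r subr0.
have wrK : (w * reflection r)%g \in weyl (b |: J) by rewrite groupM.
exists (w * reflection r)%g => // a.
have negJ c : c \in J -> (w * reflection r)%g c = neg_root c.
  move=> cJ; rewrite permM wneg // reflection_neg; congr neg_root.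
  by apply: root_inj; rewrite root_reflection rJ // scale0r subr0.
rewrite in_setU1 => /orP[/eqP ->|]; last exact: negJ.
have [L HL] := weyl_linear wrK.
have Lr : L (root r) = - root r by rewrite -HL permM wr root_neg.
apply: root_inj; rewrite HL root_neg.
have zbR : (z b)%:~R != 0 :> R by rewrite intr_eq0.
apply: (scalerI zbR); rewrite -linearZ /= scalerN.
move: rE; rewrite big_setU1 //= => rE.
have -> : (z b)%:~R *: root b = root r - \sum_(a in J) (z a)%:~R *: root a.
  by rewrite rE addrK.
rewrite linearB /= Lr opprB addrC linear_sum; congr (_ - _).
rewrite -sumrN; apply: eq_bigr => c cJ.
by rewrite linearZ /= -HL negJ // root_neg scalerN opprK.
Qed.

Lemma has_neg_isolated J b : has_neg J -> b \notin J ->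
  (forall a, a \in J -> cartan a b = 0) -> has_neg (b |: J).
Proof.
move=> nJ bnJ bJ; apply: (has_neg_setU1 (r := b) (z := fun a => (a == b)%:Z) nJ) => //.
- by apply: reflection_weyl; rewrite setU11.
- rewrite big_setU1 //= eqxx scale1r big1 ?addr0 // => a aJ.
  by case: eqVneq aJ bnJ => [->->|_ _ _] //; rewrite scale0r.
- by rewrite eqxx.
Qed.

Definition mult a b : nat := `|cartan a b|%N.

Section Positivity.
Variables (D : {set Phi}) (baseD : is_base D).

Lemma cartan_mult a b : a \in D -> b \in D -> a != b -> cartan a b = - (mult a b)%:Z.
Proof.
by move=> aD bD /(cartan_base_le0 baseD aD bD); rewrite /mult; lia.
Qed.

Lemma mult_eq0 a b : (mult a b == 0%N) = (mult b a == 0%N).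
Proof. by rewrite /mult !absz_eq0 cartan_eq0. Qed.

Lemma no_affine (c : Phi -> nat) :
  (forall a, (0 < c a)%N -> a \in D /\ exists s : seq Phi,
     [/\ uniq (a :: s), {subset s <= D} & ((c a).*2 <= \sum_(b <- s) c b * mult a b)%N]) ->
  forall a, c a = 0%N.
Proof.
move=> rows a; apply/eqP; rewrite -(eqr_nat int); apply/eqP; rewrite natz.
move: a; apply: (no_semipositive (proj1 baseD)) => [a aD|a aD].
  by case: (posnP (c a)) => [->//|/rows[]]; rewrite (negPf aD).
case: (posnP (c a)) => [->|ca]; first by rewrite mul0r.
have [_ [s [/= /andP[as_ us] sD row]]] := rows a ca.
rewrite pmulr_rle0 ?ltz_nat // (bigD1 a) //= cartan_diag.
have -> : \sum_(b in D | b != a) (c b)%:Z * cartan a b =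
    - (\sum_(b in D | b != a) c b * mult a b)%N%:Z.
  rewrite (big_morph Posz PoszD (erefl 0)) -sumrN.
  apply: eq_bigr => b /andP[bD ba].
  by rewrite cartan_mult 1?eq_sym // PoszM mulrN.
have : (\sum_(b <- s) c b * mult a b <= \sum_(b in D | b != a) c b * mult a b)%N.
  rewrite big_uniq //= [X in (X <= _)%N]big_mkcond [X in (_ <= X)%N]big_mkcond.
  apply: leq_sum => b _ /=; case: ifP => // bs; rewrite sD //=.
  by case: eqVneq bs as_ => // ->->.
lia.
Qed.

End Positivity.
End Criteria.

Lemma big_sparse (s l : seq nat) (F : nat -> int) :
  uniq l -> uniq s -> {subset s <= l} -> (forall i, i \in l -> i \notin s -> F i = 0) ->
  \sum_(i <- l) F i = \sum_(i <- s) F i.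
Proof.
move=> ul us sl F0; rewrite (bigID (mem s)) /= [X in _ + X]big_seq_cond.
rewrite [X in _ + X]big1 ?addr0 => [|i /andP[]]; last exact: F0.
rewrite -big_filter; apply: perm_big; apply: uniq_perm; rewrite ?filter_uniq //.
by move=> i; rewrite mem_filter; case: (boolP (i \in s)) => //= /sl ->.
Qed.

Section Diagrams.
Variables (R : realFieldType) (V : vectType R) (Phi : root_system V).
Implicit Types (a b r : Phi) (I J K D : {set Phi}) (f : nat -> Phi).
Implicit Types (M : nat -> nat -> int) (n : nat) (s : seq nat).

Definition img f s : {set Phi} := [set x in map f s].

Lemma img_nil f : img f [::] = set0.
Proof. by apply/setP => x; rewrite !inE. Qed.

Lemma img_cons f i s : img f (i :: s) = f i |: img f s.
Proof. by apply/setP => x; rewrite !inE. Qed.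

Lemma mem_img f i s : i \in s -> f i \in img f s.
Proof. by move=> i_s; rewrite inE map_f. Qed.

Lemma imgP f s a : reflect (exists2 i, i \in s & a = f i) (a \in img f s).
Proof. by rewrite inE; exact: mapP. Qed.

Lemma eq_img f s s' : s =i s' -> img f s = img f s'.
Proof. by move=> ss'; apply/setP => x; rewrite !inE; apply: eq_mem_map. Qed.

Definition diagram n M f J : Prop :=
  [/\ {in gtn n &, injective f}, J = img f (iota 0 n)
    & forall i j, (i < n)%N -> (j < n)%N -> cartan (f i) (f j) = M i j].

Lemma of_typeP X J : (0 < rank X)%N ->
  of_type X J <-> exists f, diagram (rank X) (cartan_matrix X) f J.
Proof.
move=> n_gt0; split=> [[g [ginj Jg gM]]|[f [finj Jf fM]]].
  pose h (k : nat) : 'I_(rank X) := insubd (Ordinal n_gt0) k.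
  have hE k : (k < rank X)%N -> h k = k :> nat by move=> kn; rewrite val_insubd kn.
  exists (g \o h); split=> [i j iX jX /ginj /(congr1 val)| |i j ilt jlt].
  - by rewrite /= !hE.
  - rewrite Jg; apply/setP => x; apply/imsetP/imgP => [[i _ ->]|[i]].
      exists (val i); first by rewrite mem_iota /=.
      by congr g; apply: val_inj; rewrite /= hE.
    by rewrite mem_iota => /andP[_ ilt] ->; exists (h i).
  - by rewrite gM !hE.
exists (fun i => f i); split=> [i j fij| |i j].
- by apply: val_inj; apply: finj => //; rewrite inE /=.
- rewrite Jf; apply/setP => x; apply/imgP/imsetP => [[i]|[i _ ->]].
    by rewrite mem_iota => /andP[_ ilt] ->; exists (Ordinal ilt).
  by exists (val i); rewrite ?mem_iota /=.
- exact: fM.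
Qed.

Lemma diagram_uniq n M f J s : diagram n M f J -> uniq s -> all (gtn n) s ->
  uniq (map f s).
Proof.
case=> finj _ _ us /allP sn; rewrite map_inj_in_uniq // => i j /sn ? /sn ?; exact: finj.
Qed.

Definition pull f s (y : nat -> int) (a : Phi) : int :=
  if a \in map f s then y (nth 0%N s (index a (map f s))) else 0.

Lemma pullE f s y i : uniq (map f s) -> i \in s -> pull f s y (f i) = y i.
Proof.
move=> us i_s; rewrite /pull map_f //; congr y.
rewrite -{1}(nth_index 0%N i_s) -(nth_map 0%N (f 0)) ?index_mem //.
by rewrite index_uniq ?size_map ?index_mem // nth_index.
Qed.

Lemma pull_out f s y a : a \notin img f s -> pull f s y a = 0.
Proof. by rewrite inE /pull => /negPf ->. Qed.

Lemma big_img (W : nmodType) f s (F : Phi -> W) : uniq (map f s) ->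
  \sum_(a in img f s) F a = \sum_(i <- s) F (f i).
Proof.
move=> us; transitivity (\sum_(a <- map f s) F a); last by rewrite big_map.
by rewrite big_uniq //=; apply: eq_bigl => x; rewrite inE.
Qed.

Lemma cartan_comb r a f s (z : nat -> int) :
  root r = \sum_(i <- s) (z i)%:~R *: root (f i) ->
  cartan r a = \sum_(i <- s) z i * cartan (f i) a.
Proof.
move=> rE; apply/eqP; rewrite -(eqr_int R) -cartanE rE linear_sum rmorph_sum.
by apply/eqP/eq_bigr => i _; rewrite linearZ /= cartanE rmorphM.
Qed.

Lemma has_neg_cons f j s r (z : nat -> int) :
  uniq (map f (j :: s)) -> has_neg (img f s) -> reflection r \in weyl (img f (j :: s)) ->
  (forall i, i \in s -> cartan r (f i) = 0) ->
  root r = \sum_(i <- j :: s) (z i)%:~R *: root (f i) -> z j != 0 ->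
  has_neg (img f (j :: s)).
Proof.
move=> us ns rK rs rE zj; rewrite img_cons.
apply: (has_neg_setU1 (r := r) (z := pull f (j :: s) z)) => //.
- by rewrite -img_cons.
- by move=> a /imgP[i i_s ->]; apply/eqP; rewrite cartan_eq0 rs.
- rewrite -img_cons big_img // rE big_seq [in RHS]big_seq.
  by apply: eq_bigr => i i_s; rewrite pullE.
- by rewrite pullE // mem_head.
Qed.

Lemma not_has_neg_weight D I K n M f (y : nat -> int) (N : int) :
  is_base D -> I \subset D -> has_neg I -> diagram n M f K -> K \subset I ->
  (forall a b, a \in K -> b \in I -> b \notin K -> cartan a b = 0) ->
  (forall j, (j < n)%N -> (N %| \sum_(i <- iota 0 n) y i * M i j)%Z) ->
  forall i, (i < n)%N -> (N %| 2 * y i)%Z.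
Proof.
move=> baseD ID nI dK KI Kiso yN i ilt.
have [finj Kf fM] := dK.
have us : uniq (map f (iota 0 n)).
  by apply: (diagram_uniq dK); rewrite ?iota_uniq //; apply/allP => j; rewrite mem_iota.
have := has_neg_weight (x := pull f (iota 0 n) y) (N := N) baseD ID nI.
have sumK j : \sum_(i in I) pull f (iota 0 n) y i * cartan i j =
    \sum_(i <- iota 0 n) y i * cartan (f i) j.
  rewrite (big_setID K) /= (setIidPr KI) [X in _ + X]big1 ?addr0; last first.
    by move=> a /setDP[_ aK]; rewrite pull_out ?mul0r // -Kf.
  rewrite Kf big_img // big_seq [RHS]big_seq; apply: eq_bigr => k ks.
  by rewrite pullE.
move=> H; have := H _ _ (f i); rewrite pullE ?mem_iota //; apply.
  by move=> a aI; rewrite pull_out // -Kf; apply: contra aI; exact: subsetP.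
move=> b bI; rewrite sumK; have [bK|bK] := boolP (b \in K).
  have := bK; rewrite Kf => /imgP[j]; rewrite mem_iota => jlt ->.
  rewrite big_seq (eq_bigr (fun i => y i * M i j)) -?big_seq; first exact: yN.
  by move=> k; rewrite mem_iota => klt; rewrite fM.
rewrite big_seq big1 ?dvdz0 // => k ks; rewrite Kiso ?mulr0 //.
by rewrite Kf mem_img.
Qed.

End Diagrams.

(** * Types realizing the negative identity *)

Definition chain_matrix (p q n i j : nat) : int :=
  if (i.+2 == n) && (j.+1 == n) then - p%:Z
  else if (i.+1 == n) && (j.+2 == n) then - q%:Z else simply_laced chain i j.

Ltac decide_if :=
  match goal with |- context [if ?b then _ else _] =>
    first [ rewrite (_ : b = false); [ | lia] | rewrite (_ : b = true); [ | lia]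
          | case: (boolP b) => ? ] end.

Ltac entry := rewrite /cartan_matrix /chain_matrix /simply_laced /chain /=;
  repeat decide_if; lia.

Lemma chain_matrixB n i j : cartan_matrix (DynkinB n) i j = chain_matrix 2 1 n i j.
Proof. entry. Qed.

Lemma chain_matrixC n i j : cartan_matrix (DynkinC n) i j = chain_matrix 1 2 n i j.
Proof. entry. Qed.

Ltac sparse l := rewrite (@big_sparse l); [ | exact: iota_uniq | | | ];
  [ rewrite ?big_cons ?big_nil | rewrite /= ?inE; lia
  | by move=> ?; rewrite !inE mem_iota; lia
  | move=> ?; rewrite !inE mem_iota /= => ? ?; try (apply/eqP; rewrite mulf_eq0; apply/orP; right; apply/eqP); entry ].

Lemma chainA_weight n j : (2 <= n)%N -> (j < n)%N ->
  (n.+1%:Z %| \sum_(i <- iota 0 n) i.+1%:Z * simply_laced chain i j)%Z.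
Proof.
move=> n2 jn; have [->|j0] := eqVneq j 0%N.
  by sparse [:: 0; 1]%N; apply/dvdzP; exists 0; entry.
have [->|jn1] := eqVneq j n.-1.
  by sparse [:: n.-2; n.-1]%N; apply/dvdzP; exists 1; entry.
by sparse [:: j.-1; j; j.+1]%N; apply/dvdzP; exists 0; entry.
Qed.

(* Four times the fundamental weight attached to the last vertex of D_n. *)
Definition spin_weight n i : int :=
  if i == n.-1 then n%:Z else if i == n.-2 then n%:Z - 2 else (2 * i.+1)%N%:Z.

Lemma spin_weightP n j : (4 <= n)%N -> (j < n)%N ->
  (4 %| \sum_(i <- iota 0 n) spin_weight n i * cartan_matrix (DynkinD n) i j)%Z.
Proof.
move=> n4 jn; have [->|j0] := eqVneq j 0%N.
  by sparse [:: 0; 1]%N; apply/dvdzP; exists 0; rewrite /spin_weight; entry.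
have [->|jn1] := eqVneq j n.-1.
  by sparse [:: (n - 3)%N; n.-1]%N; apply/dvdzP; exists 1; rewrite /spin_weight; entry.
have [->|jn2] := eqVneq j n.-2.
  by sparse [:: (n - 3)%N; n.-2]%N; apply/dvdzP; exists 0; rewrite /spin_weight; entry.
have [->|jn3] := eqVneq j (n - 3)%N.
  by sparse [:: (n - 4)%N; (n - 3)%N; n.-2; n.-1]%N; apply/dvdzP; exists 0; rewrite /spin_weight; entry.
by sparse [:: j.-1; j; j.+1]%N; apply/dvdzP; exists 0; rewrite /spin_weight; entry.
Qed.

(* Three times the fundamental weight attached to an end of the long chain, modulo 3. *)
Definition E6_weight i : int := nth 0 [:: 1; 0; 2; 0; 1; 2] i.

Lemma E6_weightP j : (j < 6)%N ->
  (3 %| \sum_(i <- iota 0 6) E6_weight i * cartan_matrix (DynkinE 6) i j)%Z.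
Proof. by rewrite !big_cons big_nil; case: j => [|[|[|[|[|[|]]]]]]. Qed.

Section NegativeIdentity.
Variables (R : realFieldType) (V : vectType R) (Phi : root_system V).
Implicit Types (a b r : Phi) (I J K D : {set Phi}) (f : nat -> Phi).

Lemma iota_cons k n : (k < n)%N -> iota k (n - k) = k :: iota k.+1 (n - k.+1).
Proof. by move=> kn; rewrite -[(n - k)%N]prednK ?subn_gt0 //= subnS. Qed.

Lemma diagram_uniq_iota n M f J k : diagram n M f J ->
  uniq (map f (iota k (n - k))).
Proof.
move=> dJ; apply: (diagram_uniq dJ); rewrite ?iota_uniq //.
by apply/allP => i; rewrite mem_iota /=; lia.
Qed.

Lemma reflection_reflection a r :
  reflection (reflection a r) = (reflection a * reflection r * reflection a)%g.
Proof.
have aW : reflection a \in weyl [set a] by rewrite reflection_weyl ?set11.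
by rewrite -mulgA (reflection_weyl_conj r aW) mulgA reflection_mulK mul1g.
Qed.

Lemma reflection_img f (s : seq nat) k r : k \in s -> reflection r \in weyl (img f s) ->
  reflection (reflection (f k) r) \in weyl (img f s).
Proof.
move=> ks rs; rewrite reflection_reflection.
by rewrite !groupM // reflection_weyl // mem_img.
Qed.

Lemma weyl_img f (s s' : seq nat) (w : {perm Phi}) : {subset s <= s'} -> w \in weyl (img f s) ->
  w \in weyl (img f s').
Proof.
move=> ss'; apply/subsetP/weylS/subsetP => x /imgP[i i_s ->].
by rewrite mem_img ?ss'.
Qed.

(* The roots e_k of B_n, or 2 e_k of C_n. *)
Lemma chain_axis p q n f J k : diagram n (chain_matrix p q n) f J -> (k < n)%N ->
  exists2 r : Phi, reflection r \in weyl (img f (iota k (n - k))) &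
    root r = \sum_(i <- iota k (n - k))
       (if i == n.-1 then 1 else q%:Z)%:~R *: root (f i).
Proof.
case=> _ _ fM; elim: {k}(n - k)%N {-2}k (leqnn (n - k)) => [|m IHm] k mk kn; first by lia.
have [kn1|kn1] := eqVneq k n.-1.
  exists (f k).
    by rewrite iota_cons // reflection_weyl // mem_img ?mem_head.
  rewrite iota_cons // (_ : (n - k.+1 = 0)%N); last by lia.
  by rewrite big_seq1 kn1 eqxx scale1r.
have k1n : (k.+1 < n)%N by lia.
have [|r rW rE] := IHm k.+1 _ k1n; first by lia.
have rk : cartan r (f k) = - q%:Z.
  rewrite (cartan_comb _ rE) big_seq (eq_bigr (fun i => (if i == n.-1 then 1 else q%:Z) *
    chain_matrix p q n i k)) -?big_seq; last by move=> i; rewrite mem_iota => ?; rewrite fM //; lia.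
  by sparse [:: k.+1]; entry.
exists (reflection (f k) r).
  apply: reflection_img; first by rewrite iota_cons ?mem_head.
  by apply: weyl_img rW => i; rewrite !mem_iota; lia.
by rewrite root_reflection rk iota_cons // big_cons (negPf kn1) -rE rmorphN scaleNr opprK addrC.
Qed.

Lemma has_neg_chain p q n f J : diagram n (chain_matrix p q n) f J ->
  (p * q = 2)%N -> has_neg J.
Proof.
move=> dJ pq; have [finj Jf fM] := dJ.
suff H k : (k <= n)%N -> has_neg (img f (iota k (n - k))).
  by have := H 0%N isT; rewrite subn0 -Jf.
elim: {k}(n - k)%N {-2}k (leqnn (n - k)) => [|m IHm] k mk kn.
  by rewrite (_ : (n - k = 0)%N) ?img_nil; [exact: has_neg0|lia].
have [->|k_n] := eqVneq k n; first by rewrite subnn img_nil; exact: has_neg0.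
have {}kn : (k < n)%N by lia.
have [r rW rE] := chain_axis dJ kn; rewrite iota_cons // in rW rE *.
apply: has_neg_cons (rW) _ (rE) _.
- by rewrite -iota_cons // (diagram_uniq_iota _ dJ).
- by apply: IHm; lia.
- move=> j; rewrite mem_iota => jlt.
  rewrite (cartan_comb _ rE) -iota_cons // big_seq (eq_bigr (fun i =>
    (if i == n.-1 then 1 else q%:Z) * chain_matrix p q n i j)) -?big_seq; last first.
    by move=> i; rewrite mem_iota => ?; rewrite fM //; lia.
  have [->|jn1] := eqVneq j n.-1.
    sparse [:: n.-2; n.-1]%N; entry.
  sparse [:: j.-1; j; j.+1]%N; entry.
- by case: ifP => // _; lia.
Qed.


Definition D_axis n k i : int :=
  if (i == k) || (n <= i.+2)%N then 1 else 2.

(* The roots e_k + e_{k+1} of D_n. *)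
Lemma D_axis_root n f J k : diagram n (cartan_matrix (DynkinD n)) f J ->
  (k.+3 <= n)%N -> (3 <= n)%N ->
  exists2 r : Phi, reflection r \in weyl (img f (iota k (n - k))) &
    root r = \sum_(i <- iota k (n - k)) (D_axis n k i)%:~R *: root (f i).
Proof.
case=> _ _ fM kn n3.
have n1 : (n.-1 < n)%N by lia.
have n2 : (n.-2 < n)%N by lia.
have n3' : (n - 3 < n)%N by lia.
elim: {k}(n - k)%N {-2}k (leqnn (n - k)) kn => [|m IHm] k mk kn; first by lia.
have [kn3|kn3] := eqVneq k (n - 3)%N.
  exists (reflection (f n.-1) (reflection (f n.-2) (f (n - 3)%N))).
    do 2 (apply: reflection_img; first by rewrite mem_iota; lia).
    by rewrite reflection_weyl // mem_img // mem_iota; lia.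
  have -> : iota k (n - k) = [:: (n - 3)%N; n.-2; n.-1]%N.
    by rewrite kn3 (_ : (n - (n - 3) = 3)%N) /=; [congr [:: _; _; _]; lia|lia].
  rewrite !big_cons big_nil addr0 !root_reflection cartan_reflection !fM //.
  have -> : D_axis n k (n - 3)%N = 1 by rewrite /D_axis; entry.
  have -> : D_axis n k n.-2 = 1 by rewrite /D_axis; entry.
  have -> : D_axis n k n.-1 = 1 by rewrite /D_axis; entry.
  have -> : cartan_matrix (DynkinD n) (n - 3)%N n.-1 = -1 by entry.
  have -> : cartan_matrix (DynkinD n) (n - 3)%N n.-2 = -1 by entry.
  have -> : cartan_matrix (DynkinD n) n.-2 n.-1 = 0 by entry.
  by rewrite mulr0 subr0 rmorphN !scaleNr !opprK !scale1r addrA.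
have k1n : (k.+4 <= n)%N by lia.
have [|r rW rE] := IHm k.+1 _ k1n; first by lia.
have rk : cartan r (f k) = - 1.
  rewrite (cartan_comb _ rE) big_seq (eq_bigr (fun i => D_axis n k.+1 i *
    cartan_matrix (DynkinD n) i k)) -?big_seq; last by move=> i; rewrite mem_iota => ?; rewrite fM //; lia.
  by sparse [:: k.+1]; rewrite /D_axis; entry.
have rk1 : cartan r (f k.+1) = 0.
  rewrite (cartan_comb _ rE) big_seq (eq_bigr (fun i => D_axis n k.+1 i *
    cartan_matrix (DynkinD n) i k.+1)) -?big_seq; last by move=> i; rewrite mem_iota => ?; rewrite fM //; lia.
  have [->|kn4] := eqVneq k (n - 4)%N.
    by sparse [:: (n - 3)%N; n.-2; n.-1]%N; rewrite /D_axis; entry.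
  by sparse [:: k.+1; k.+2]; rewrite /D_axis; entry.
exists (reflection (f k.+1) (reflection (f k) r)).
  do 2 (apply: reflection_img; first by rewrite mem_iota; lia).
  by apply: weyl_img rW => i; rewrite !mem_iota; lia.
rewrite !root_reflection cartan_reflection rk rk1 fM; [|lia|lia].
have -> : cartan_matrix (DynkinD n) k k.+1 = -1 by entry.
have kn0 : (k < n)%N by lia.
have kn1 : (k.+1 < n)%N by lia.
rewrite rE (iota_cons kn0) (iota_cons kn1) !big_cons.
have -> : D_axis n k k = 1 by rewrite /D_axis; entry.
have -> : D_axis n k k.+1 = 2 by rewrite /D_axis; entry.
have -> : D_axis n k.+1 k.+1 = 1 by rewrite /D_axis; entry.
rewrite (_ : \sum_(i <- iota k.+2 (n - k.+2)) (D_axis n k.+1 i)%:~R *: root (f i) =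
  \sum_(i <- iota k.+2 (n - k.+2)) (D_axis n k i)%:~R *: root (f i)); last first.
  rewrite big_seq [RHS]big_seq; apply: eq_bigr => i; rewrite mem_iota => ?.
  by congr (_%:~R *: _); rewrite /D_axis; entry.
move: (\sum_(_ <- _) _) => u.
rewrite (_ : 0 - -1 * -1 = -1 :> int) // (_ : 2%:~R = 1 + 1 :> R) //.
rewrite rmorphN !scaleNr !opprK scalerDl.
by rewrite !scale1r addrAC addrC; congr (_ + _); rewrite addrAC.
Qed.

Lemma D_axis_orth n k j : (k.+4 <= n)%N -> (j < n)%N -> (j == k) || (k.+2 <= j)%N ->
  \sum_(i <- iota k (n - k)) D_axis n k i * cartan_matrix (DynkinD n) i j = 0.
Proof.
move=> kn jn jk; have [->|j_k] := eqVneq j k.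
  by sparse [:: k; k.+1]; rewrite /D_axis; entry.
have {jk j_k} kj : (k.+2 <= j)%N by lia.
have [->|jn1] := eqVneq j n.-1.
  by sparse [:: (n - 3)%N; n.-1]%N; rewrite /D_axis; entry.
have [->|jn2] := eqVneq j n.-2.
  by sparse [:: (n - 3)%N; n.-2]%N; rewrite /D_axis; entry.
have [jn3|jn3] := eqVneq j (n - 3)%N.
  by sparse [:: (n - 4)%N; (n - 3)%N; n.-2; n.-1]%N; rewrite /D_axis; entry.
by sparse [:: j.-1; j; j.+1]%N; rewrite /D_axis; entry.
Qed.

Lemma has_neg_D n f J : diagram n (cartan_matrix (DynkinD n)) f J ->
  (4 <= n)%N -> ~~ odd n -> has_neg J.
Proof.
move=> dJ n4 n_even; have [finj Jf fM] := dJ.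
suff H k : (k <= n)%N -> ~~ odd k -> has_neg (img f (iota k (n - k))).
  by have := H 0%N isT isT; rewrite subn0 -Jf.
elim: {k}(n - k)%N {-2}k (leqnn (n - k)) => [|m IHm] k mk kn k_even.
  by rewrite (_ : (n - k = 0)%N) ?img_nil; [exact: has_neg0|lia].
have [->|k_n] := eqVneq k n; first by rewrite subnn img_nil; exact: has_neg0.
have {}kn : (k.+1 < n)%N by lia.
have kn' : (k < n)%N by lia.
have us := diagram_uniq_iota k dJ.
have iE : iota k (n - k) = [:: k, k.+1 & iota k.+2 (n - k.+2)].
  by rewrite (iota_cons kn') (iota_cons kn).
rewrite iE /= in us.
have nJ : has_neg (img f (k :: iota k.+2 (n - k.+2))).
  rewrite img_cons; apply: has_neg_isolated; first by apply: IHm; lia.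
    by move: us => /andP[+ _]; rewrite !inE negb_or => /andP[_].
  move=> a /imgP[i]; rewrite mem_iota => ilt ->; rewrite fM; [|lia|lia]; entry.
have -> : img f (iota k (n - k)) = img f (k.+1 :: k :: iota k.+2 (n - k.+2)).
  by apply: eq_img => i; rewrite iE !inE orbCA.
have us' : uniq (map f (k.+1 :: k :: iota k.+2 (n - k.+2))).
  rewrite /= !inE; move: us; rewrite !inE !negb_or eq_sym => /and3P[/andP[-> ->] -> ->].
  by [].
have [kn2|kn2] := eqVneq k.+2 n.
  move: nJ us'; rewrite kn2 subnn /= => nJ /andP[k1k _].
  rewrite img_cons; apply: has_neg_isolated => //; first by rewrite inE.
  by move=> a; rewrite img_cons img_nil setU0 => /set1P->; rewrite fM //; entry.
have [||r rW rE] := D_axis_root dJ (_ : (k.+3 <= n)%N); [lia|lia|].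
have pE : perm_eq (iota k (n - k)) (k.+1 :: k :: iota k.+2 (n - k.+2)).
  by rewrite iE; apply/seq.permP => P /=; rewrite addnCA.
apply: has_neg_cons us' nJ _ _ _ _.
- by apply: weyl_img rW => i; rewrite (perm_mem pE).
- move=> j js; have {}js : (j == k) || (k.+2 <= j < n)%N.
    by move: js; rewrite inE mem_iota; lia.
  have jn : (j < n)%N by lia.
  rewrite (cartan_comb _ rE) big_seq (eq_bigr (fun i => D_axis n k i *
    cartan_matrix (DynkinD n) i j)) -?big_seq; first by apply: D_axis_orth; lia.
  by move=> i; rewrite mem_iota => ?; rewrite fM //; lia.
- by rewrite rE (perm_big _ pE).
- by rewrite /D_axis; entry.
Qed.

Definition reflect_coord n M (v : seq int) (i : nat) : seq int :=
  set_nth 0 v i (nth 0 v i -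
    foldr (fun j x => nth 0 v j * M j i + x) 0 (iota 0 n)).

Definition word_is_neg n M (t : seq nat) : bool :=
  all (gtn n) t &&
  all (fun j => foldl (reflect_coord n M) (mkseq (fun i => (i == j)%:Z) n) t
             == mkseq (fun i => - (i == j)%:Z) n) (iota 0 n).

Lemma has_neg_word n M f J t : diagram n M f J -> word_is_neg n M t -> has_neg J.
Proof.
move=> [finj Jf fM] /andP[tn /allP tneg].
have coordE v i b : (i < n)%N -> size v = n ->
    root b = \sum_(j <- iota 0 n) (nth 0 v j)%:~R *: root (f j) ->
    size (reflect_coord n M v i) = n /\
    root (reflection (f i) b) =
      \sum_(j <- iota 0 n) (nth 0 (reflect_coord n M v i) j)%:~R *: root (f j).
  move=> iltn sv bE; split; first by rewrite size_set_nth sv; apply/maxn_idPr.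
  have := cartan_comb (f i) bE; rewrite root_reflection => ->.
  have -> : \sum_(j <- iota 0 n) nth 0 v j * cartan (f j) (f i) =
     foldr (fun j x => nth 0 v j * M j i + x) 0 (iota 0 n).
    have : {subset iota 0 n <= gtn n} by move=> j; rewrite mem_iota.
    elim: (iota 0 n) => [|j l IHl] ln; first by rewrite big_nil.
    rewrite big_cons /= IHl => [|h hl]; last by rewrite ln // inE hl orbT.
    by rewrite fM //; apply: ln; exact: mem_head.
  rewrite /reflect_coord; move: (foldr _ _ _) => c.
  have i_s : i \in iota 0 n by rewrite mem_iota.
  rewrite bE !(bigD1_seq i) ?iota_uniq //= nth_set_nth /= eqxx rmorphB scalerBl addrAC.
  by congr (_ + _); apply: eq_bigr => j ji; rewrite nth_set_nth /= (negPf ji).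
exists (\prod_(i <- t) reflection (f i))%g.
  rewrite Jf -(big_map f xpredT (@reflection _ _ Phi)) prod_weyl //.
  apply/allP => a /mapP[i /(allP tn) i_n ->] /=.
  by rewrite mem_img // mem_iota.
have wordE v b : size v = n ->
    root b = \sum_(j <- iota 0 n) (nth 0 v j)%:~R *: root (f j) ->
    root ((\prod_(i <- t) reflection (f i))%g b) =
    \sum_(j <- iota 0 n) (nth 0 (foldl (reflect_coord n M) v t) j)%:~R *: root (f j).
  elim: t tn v b {tneg} => [|i t IHt] /= => [_ v b _ bE|/andP[i_n tn] v b sv bE].
    by rewrite big_nil perm1 bE.
  have [sv' bE'] := coordE v i b i_n sv bE.
  by rewrite big_cons permM; apply: IHt.
move=> a; rewrite Jf => /imgP[j js ->]; apply: root_inj; rewrite root_neg.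
have eE (g : bool -> int) : \sum_(k <- iota 0 n) (nth 0 (mkseq (fun i => g (i == j)) n) k)%:~R *: root (f k)
   = \sum_(k <- iota 0 n) (g (k == j))%:~R *: root (f k).
  rewrite big_seq [RHS]big_seq; apply: eq_bigr => k; rewrite mem_iota => ?.
  by rewrite nth_mkseq.
rewrite (wordE (mkseq (fun i => (i == j)%:Z) n)) ?size_mkseq //; last first.
  rewrite (eE (fun e : bool => e%:Z)) (bigD1_seq j) ?iota_uniq //= eqxx scale1r big1 ?addr0 //.
  by move=> k /negPf ->; rewrite scale0r.
rewrite (eqP (tneg j js)) (eE (fun e : bool => - e%:Z)) (bigD1_seq j) ?iota_uniq //= eqxx.
rewrite rmorphN scaleNr scale1r big1 ?addr0 //.
by move=> k /negPf ->; rewrite rmorphN scaleNr scale0r oppr0.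
Qed.

(* The h/2-th power of a Coxeter element is -1 when the degrees are even. *)
Definition coxeter_power n k := flatten (nseq k (iota 0 n)).

Lemma has_neg_coxeter n M f J k : diagram n M f J ->
  word_is_neg n M (coxeter_power n k) -> has_neg J.
Proof. exact: has_neg_word. Qed.

Lemma has_neg_E7 f J : diagram 7 (cartan_matrix (DynkinE 7)) f J -> has_neg J.
Proof. by move=> dJ; apply: (has_neg_coxeter (k := 9) dJ); vm_compute. Qed.

Lemma has_neg_E8 f J : diagram 8 (cartan_matrix (DynkinE 8)) f J -> has_neg J.
Proof. by move=> dJ; apply: (has_neg_coxeter (k := 15) dJ); vm_compute. Qed.

Lemma has_neg_F4 f J : diagram 4 (cartan_matrix DynkinF4) f J -> has_neg J.
Proof. by move=> dJ; apply: (has_neg_coxeter (k := 6) dJ); vm_compute. Qed.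

Lemma has_neg_G2 f J : diagram 2 (cartan_matrix DynkinG2) f J -> has_neg J.
Proof. by move=> dJ; apply: (has_neg_coxeter (k := 3) dJ); vm_compute. Qed.

End NegativeIdentity.

(** * Classification by growth *)

(* The last vertex n is joined only to i0, by a bond with Cartan integers -x and -y. *)
Definition ext_matrix (M : nat -> nat -> int) n i0 (x y : nat) i j : int :=
  if (i < n)%N then if (j < n)%N then M i j else if i == i0 then - x%:Z else 0
  else if (j < n)%N then if j == i0 then - y%:Z else 0 else 2.

Definition affine_row (A : nat -> nat -> nat) n (c : nat -> nat) i : bool :=
  ((c i).*2 <= foldr (fun j x => (j != i) * c j * A i j + x) 0 (iota 0 n))%N.

Definition affine_check (A : nat -> nat -> nat) (c : seq nat) : bool :=
  all (affine_row A (size c) (nth 0 c)) (iota 0 (size c)) && has (leq 1) c.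

Section Growth.
Variables (R : realFieldType) (V : vectType R) (Phi : root_system V).
Implicit Types (a b r u v : Phi) (I J K D S : {set Phi}) (f g : nat -> Phi).

Lemma img_map f (t : nat -> nat) s : img (f \o t) s = img f (map t s).
Proof. by rewrite /img map_comp. Qed.

Lemma diagram_sub n m M M' f K (t : nat -> nat) : diagram n M f K ->
  (forall i, (i < m)%N -> (t i < n)%N) -> {in gtn m &, injective t} ->
  (forall i j, (i < m)%N -> (j < m)%N -> M' i j = M (t i) (t j)) ->
  diagram m M' (f \o t) (img (f \o t) (iota 0 m)) /\ img (f \o t) (iota 0 m) \subset K.
Proof.
move=> [finj Kf fM] tn tinj tM; split.
  split=> // [i j im jm /= /finj|i j im jm]; last by rewrite tM // fM ?tn.
  by rewrite !inE => /(_ (tn i im) (tn j jm)); apply: tinj.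
apply/subsetP => _ /imgP[i + ->]; rewrite mem_iota => im.
by rewrite /= Kf mem_img // mem_iota tn.
Qed.

Lemma diagram_card n M f K : diagram n M f K -> #|K| = n.
Proof.
move=> dK; have [_ -> _] := dK; rewrite cardsE (card_uniqP _) ?size_map ?size_iota //.
by have := diagram_uniq_iota 0 dK; rewrite subn0.
Qed.

Lemma diagram_relabel n M M' f K (t : nat -> nat) : diagram n M f K ->
  (forall i, (i < n)%N -> (t i < n)%N) -> {in gtn n &, injective t} ->
  (forall i j, (i < n)%N -> (j < n)%N -> M' i j = M (t i) (t j)) ->
  diagram n M' (f \o t) K.
Proof.
move=> dK tn tinj tM; have [dK' sub] := diagram_sub dK tn tinj tM.
have /eqP <- // : img (f \o t) (iota 0 n) == K.
by rewrite eqEcard sub (diagram_card dK) (diagram_card dK') leqnn.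
Qed.

Lemma diagram_relabel_seq n M M' f K (t : seq nat) : diagram n M f K ->
  [&& size t == n, all (gtn n) t, uniq t &
    all (fun i => all (fun j => M' i j == M (nth 0 t i) (nth 0 t j)) (iota 0 n)) (iota 0 n)] ->
  diagram n M' (f \o nth 0%N t) K.
Proof.
move=> dK /and4P[/eqP st /allP tn ut /allP tM].
apply: (diagram_relabel dK) => [i i_n|i j|i j i_n j_n].
- by apply: tn; rewrite mem_nth // st.
- by rewrite !inE -st => i_n j_n /eqP; rewrite nth_uniq // => /eqP.
- have io k : (k < n)%N -> k \in iota 0 n by rewrite mem_iota.
  by apply/eqP; have /allP/(_ j (io j j_n)) := tM i (io i i_n).
Qed.

Section Base.
Variables (D : {set Phi}) (baseD : is_base D).

Lemma no_affine_diagram n M f K (c : nat -> nat) (A : nat -> nat -> nat) :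
  diagram n M f K -> K \subset D ->
  (forall i j, (i < n)%N -> (j < n)%N -> i != j -> (A i j <= `|M i j|)%N) ->
  (forall i, (i < n)%N -> (0 < c i)%N -> exists s : seq nat,
    [/\ uniq (i :: s), all (gtn n) s & ((c i).*2 <= \sum_(j <- s) c j * A i j)%N]) ->
  forall i, (i < n)%N -> c i = 0%N.
Proof.
move=> dK KD AM rows i i_n; have [finj Kf fM] := dK.
have us : uniq (map f (iota 0 n)) by have := diagram_uniq_iota 0 dK; rewrite subn0.
have cE j : (j < n)%N -> `|pull f (iota 0 n) (fun k => (c k)%:Z) (f j)|%N = c j.
  by move=> jn; rewrite pullE ?mem_iota.
rewrite -cE //; apply: (no_affine baseD (c := fun a => `|_ a|%N)).
move=> a; have [aK|aK] := boolP (a \in K); last by rewrite pull_out // -Kf.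
have := aK; rewrite {1}Kf => /imgP[j]; rewrite mem_iota => jn aE.
rewrite aE cE // => /(rows _ jn)[s [ujs /allP sn row]]; rewrite -aE (subsetP KD) //.
split=> //; exists (map f s); split.
- rewrite aE -map_cons (diagram_uniq dK) //= [(j < n)%N]jn; exact/allP.
- move=> _ /mapP[k /sn kn ->]; apply: (subsetP KD).
  by rewrite Kf mem_img // mem_iota.
- apply: leq_trans row _; rewrite big_map big_seq [X in (_ <= X)%N]big_seq.
  apply: leq_sum => k ks; have kn := sn k ks.
  rewrite cE // leq_mul2l /mult aE fM // AM ?orbT //.
  by apply: contraTneq ujs => ->; rewrite /= ks.
Qed.

Lemma no_affine_seq n M f K (c : seq nat) (A : nat -> nat -> nat) :
  diagram n M f K -> K \subset D ->
  (forall i j, (i < n)%N -> (j < n)%N -> i != j -> (A i j <= `|M i j|)%N) ->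
  size c = n -> affine_check A c -> False.
Proof.
move=> dK KD AM sc /andP[/allP rows /hasP[k kc k_gt0]].
have kn : (index k c < n)%N by rewrite -sc index_mem.
have := no_affine_diagram (c := nth 0%N c) dK KD AM _ kn.
rewrite nth_index // => k0; move: k_gt0; rewrite k0 // => {k kc kn k0} i i_n _.
have /rows : i \in iota 0 (size c) by rewrite mem_iota sc.
rewrite /affine_row sc => row; exists (rem i (iota 0 n)); split.
- by rewrite /= mem_rem_uniq ?iota_uniq // !inE eqxx rem_uniq ?iota_uniq.
- by apply/allP => j /mem_rem; rewrite mem_iota.
- apply: leq_trans row _; rewrite (rem_filter _ (iota_uniq 0 n)) big_filter.
  elim: (iota 0 n) => [|j l IHl]; first by rewrite big_nil.
  rewrite big_cons /=; case: eqP => _ /=; first by rewrite mul0n.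
  by rewrite mul1n leq_add2l.
Qed.

Lemma mult_gt0 a b : (0 < mult a b)%N = (cartan a b != 0).
Proof. by rewrite /mult lt0n absz_eq0. Qed.

Lemma mult_bound a b : a \in D -> b \in D -> a != b -> (mult a b * mult b a <= 3)%N.
Proof.
move=> aD bD ab; rewrite leqNgt; apply/negP => ge4.
suff [x [y [x0 xy yx]]] : exists x y : nat,
    [/\ (0 < x)%N, (x.*2 <= y * mult a b)%N & (y.*2 <= x * mult b a)%N].
  have : (if a == a then x else if a == b then y else 0)%N = 0%N.
    apply: (no_affine baseD (c := fun z => if z == a then x else if z == b then y else 0)%N).
    move=> z; case: (eqVneq z a) => [-> _|_].
      split=> //; exists [:: b]; rewrite big_seq1 eqxx eq_sym (negPf ab); split=> //.
        by rewrite /= inE ab.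
      by move=> w; rewrite inE => /eqP->.
    case: (eqVneq z b) => [-> _|//].
    split=> //; exists [:: a]; rewrite big_seq1 eqxx; split=> //.
      by rewrite /= inE eq_sym ab.
    by move=> w; rewrite inE => /eqP->.
  by rewrite eqxx; lia.
have [] : (mult a b >= 2 /\ mult b a >= 2 \/ mult a b = 1 /\ mult b a >= 4 \/
   mult b a = 1 /\ mult a b >= 4)%N by nia.
- by move=> [? ?]; exists 1%N, 1%N; split; lia.
- by case=> [][? ?]; [exists 1%N, 2%N|exists 2%N, 1%N]; split; lia.
Qed.

Lemma adjacentE K a b : adjacent K a b = [&& a \in K, b \in K, a != b & (0 < mult a b)%N].
Proof. by rewrite /adjacent /= mult_gt0. Qed.

Lemma adjacent_sym K : symmetric (adjacent K).
Proof.
move=> a b; rewrite !adjacentE eq_sym [(_ < mult b a)%N]lt0n mult_eq0 -lt0n.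
by rewrite andbCA.
Qed.

Lemma no_cycle (s : seq Phi) : (2 < size s)%N -> uniq s -> {subset s <= D} ->
  path.cycle (adjacent D) s -> False.
Proof.
move=> s3 us sD cyc.
have : {in s, forall a, (a \in s : nat) = 0%N}.
  move=> a as_; apply: (no_affine baseD (c := fun b => (b \in s) : nat)) => b.
  rewrite lt0b => bs; split; first exact: sD.
  have [i t st] := rot_to bs.
  have cyc' : path.cycle (adjacent D) (b :: t) by rewrite -st rot_cycle.
  have us' : uniq (b :: t) by rewrite -st rot_uniq.
  have sE : s =i b :: t by move=> x; rewrite -st mem_rot.
  have: (2 < size (b :: t))%N by rewrite -st size_rot.
  case: t {st} cyc' us' sE => [|c [|d t]] //= + us' sE _.
  case/and3P=> bc cd; rewrite rcons_path => /andP[_ eb].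
  have lt : last d t \in d :: t := mem_last d t.
  exists [:: c; last d t].
  move: bc eb; rewrite [adjacent D (last _ _) _]adjacent_sym !adjacentE.
  move=> /and4P[_ cD bc m1] /and4P[_ lD bl m2]; split.
  - rewrite /= !inE negb_or bc bl /= andbT.
    by move: us' => /and4P[_ + _ _]; apply: contraNneq => ->.
  - by move=> x; rewrite !inE => /orP[] /eqP->.
  - rewrite big_cons big_seq1 !sE !inE !eqxx /=.
    have -> : (last d t == b) || ((last d t == c) || ((last d t == d) || (last d t \in t))).
      by move: lt; rewrite inE => ->; rewrite !orbT.
    by rewrite orbT !mul1n; exact: (leq_add m1 m2).
by case: s s3 {us sD cyc} => // a s _ /(_ a (mem_head a s)); rewrite mem_head.
Qed.

End Base.
End Growth.

Section Attach.
Variables (R : realFieldType) (V : vectType R) (Phi : root_system V).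
Implicit Types (a b r u v : Phi) (I J K D S : {set Phi}) (f g : nat -> Phi).

Lemma sub_adjacent J K : J \subset K -> subrel (adjacent J) (adjacent K).
Proof.
move=> JK a b; rewrite !adjacentE => /and4P[/(subsetP JK)-> /(subsetP JK)->].
by move=> -> ->.
Qed.

Lemma sub_connect_adjacent J K : J \subset K ->
  subrel (connect (adjacent J)) (connect (adjacent K)).
Proof. by move=> JK; apply: connect_sub => a b /(sub_adjacent JK)/connect1. Qed.

Lemma connected_setU1 K u v : connected K -> u \in K -> (0 < mult u v)%N -> v != u ->
  connected (v |: K).
Proof.
move=> [_ conK] uK uv vu; have KvK : K \subset v |: K := subsetUr _ _.
have cuv : connect (adjacent (v |: K)) u v.
  by apply: connect1; rewrite adjacentE uv eq_sym vu !inE eqxx uK orbT.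
split; first by apply/set0Pn; exists v; rewrite setU11.
have cu a : a \in v |: K -> connect (adjacent (v |: K)) u a.
  rewrite !inE => /orP[/eqP->//|aK].
  by apply: sub_connect_adjacent KvK _ _ _; exact: conK.
move=> a b aK bK; apply: connect_trans (cu b bK).
by rewrite (sym_connect_sym (@adjacent_sym _ _ _ _)) cu.
Qed.

Section Base.
Variables (D : {set Phi}) (baseD : is_base D).

Lemma path_sub K a q : path (adjacent K) a q -> {subset q <= K}.
Proof.
elim: q a => [//|b q IHq] a /= /andP[+ /IHq qK] x.
by rewrite adjacentE inE => /and4P[_ bK _ _] /orP[/eqP->|/qK].
Qed.

Lemma unique_neighbour K u u' v : connected K -> K \subset D -> v \in D -> v \notin K ->
  u \in K -> u' \in K -> (0 < mult u v)%N -> (0 < mult u' v)%N -> u = u'.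
Proof.
move=> [_ conK] KD vD vK uK u'K uv u'v; apply/eqP/negPn/negP => uu'.
have [p pth lst] := connectP (conK u u' uK u'K).
case: (shortenP pth) lst => {pth}q pth uq _ lst.
have qK := path_sub pth.
apply: (no_cycle baseD (s := v :: u :: q)).
- by case: q lst {pth uq qK} uu' => [->|]; rewrite ?eqxx.
- rewrite cons_uniq uq andbT; apply: contra vK; rewrite inE => /orP[/eqP->//|]; exact: qK.
- by move=> x; rewrite !inE => /or3P[/eqP->|/eqP->|/qK/(subsetP KD)]; rewrite ?(subsetP KD u).
have uv' : u != v by apply: contraNneq vK => <-.
have uv'' : u' != v by apply: contraNneq vK => <-.
have uD := subsetP KD u uK; have u'D := subsetP KD u' u'K.
rewrite /= rcons_path -lst (sub_path (sub_adjacent KD) pth) /=.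
rewrite [adjacent D v u]adjacent_sym !adjacentE uD u'D vD uv' uv'' uv u'v.
by [].
Qed.

Lemma attach n M f K v : diagram n M f K -> connected K -> K \subset D -> v \in D ->
  v \notin K -> (exists2 u, u \in K & (0 < mult u v)%N) ->
  exists i0 x y, [/\ (i0 < n)%N, (0 < x)%N, (0 < y)%N, (x * y <= 3)%N &
    exists g, diagram n.+1 (ext_matrix M n i0 x y) g (v |: K)].
Proof.
move=> dK conK KD vD vK [u uK uv]; have [finj Kf fM] := dK.
have := uK; rewrite {1}Kf => /imgP[i0]; rewrite mem_iota => i0n uE.
have uv' : u != v by apply: contraNneq vK => <-.
have uD := subsetP KD u uK.
exists i0, (mult u v), (mult v u); split=> //.
- by rewrite lt0n mult_eq0 -lt0n.
- exact: (mult_bound baseD uD vD uv').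
have fK i : (i < n)%N -> f i \in K by move=> i_n; rewrite Kf mem_img // mem_iota.
have fv i : (i < n)%N -> f i != v by move=> i_n; apply: contraNneq vK => <-; exact: fK.
have f0 i : (i < n)%N -> i != i0 -> cartan (f i) v = 0.
  move=> i_n ii0; apply/eqP/negPn; rewrite -mult_gt0; apply: contra ii0 => fiv.
  apply/eqP/finj => //; rewrite -uE.
  exact: unique_neighbour conK KD vD vK (fK i i_n) uK fiv uv.
exists (fun i => if (i < n)%N then f i else v); split.
- move=> i j; rewrite !inE !ltnS => i_n j_n; case: ltnP => [{}i_n|ni]; case: ltnP => [{}j_n|nj].
  + exact: finj.
  + by move=> /eqP; rewrite (negPf (fv i i_n)).
  + by move=> /esym/eqP; rewrite (negPf (fv j j_n)).
  + by lia.
- apply/setP => x; apply/setU1P/imgP => [[->|]|[i]].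
  + by exists n; rewrite ?mem_iota ?leqnn ?ltnn.
  + rewrite Kf => /imgP[i]; rewrite mem_iota => i_n ->; have {}i_n : (i < n)%N by [].
    by exists i; rewrite ?i_n // mem_iota add0n (leqW i_n).
  + by rewrite mem_iota => i_n ->; case: ltnP => [/fK|_]; [right|left].
- move=> i j i_n j_n; rewrite /ext_matrix; case: ltnP => i_n'; case: ltnP => j_n'.
  + exact: fM.
  + case: eqVneq => [->|/(f0 i i_n')//].
    by rewrite -uE (cartan_mult baseD).
  + case: eqVneq => [->|/(f0 j j_n') /eqP].
      by rewrite -uE (cartan_mult baseD) // eq_sym.
    by rewrite cartan_eq0 => /eqP.
  + exact: cartan_diag.
Qed.

Lemma growth_ind (P : {set Phi} -> Prop) K S : S \subset D -> connected S -> K \subset S ->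
  connected K -> P K ->
  (forall J v, J \subset S -> connected J -> P J -> v \in S -> v \notin J ->
    (exists2 u, u \in J & (0 < mult u v)%N) -> P (v |: J)) -> P S.
Proof.
move=> SD [S0 conS] KS conK PK step.
elim: {K}#|S :\: K| {-2}K (leqnn #|S :\: K|) KS conK PK => [|m IHm] K le KS conK PK.
  suff -> : S = K by [].
  by apply/eqP; rewrite eqEsubset KS -setD_eq0 -cards_eq0 -leqn0 le.
have [->|KnS] := eqVneq S K; first by [].
have [v /andP[/andP[vS vK] /exists_inP[u uK uv]]|none] := pickP
   [pred v | (v \in S) && (v \notin K) && [exists u in K, (0 < mult u v)%N]].
  have vu : v != u by apply: contraNneq vK => ->.
  apply: (IHm (v |: K)).
  - rewrite -ltnS; apply: leq_trans le; apply: proper_card; apply/properP; split.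
      by apply/subsetP => x; rewrite !inE negb_or => /andP[/andP[_ ->] ->].
    by exists v; rewrite !inE ?vK ?vS ?eqxx.
  - by rewrite subUset sub1set vS.
  - exact: connected_setU1 conK uK uv vu.
  - by apply: step => //; exists u.
case: conK => /set0Pn[a aK] _.
have closedK : closed (adjacent S) (mem K).
  apply: intro_closed; first exact: sym_connect_sym (@adjacent_sym _ _ _ _).
  move=> x y; rewrite adjacentE => /and4P[xS yS _ xy] xK.
  have := none y; rewrite /= yS /=; case: (y \in K) => //= /existsP[]; exists x.
  by rewrite xK.
case/eqP: KnS; apply/eqP; rewrite eqEsubset KS andbT; apply/subsetP => b bS.
have <- // : (a \in K) = (b \in K).
by apply: (closed_connect closedK); apply: conS => //; apply: (subsetP KS).
Qed.

End Base.
End Attach.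

(* c plays the role of the marks of an affine diagram: the corresponding combination
   of simple coroots is non-positive on every simple root of its support. *)
Definition affine_rows (M : nat -> nat -> int) n (c : nat -> nat) : Prop :=
  forall i, (i < n)%N -> (0 < c i)%N -> exists s : seq nat,
    [/\ uniq (i :: s), all (gtn n) s & ((c i).*2 <= \sum_(j <- s) c j * `|M i j|)%N].

Ltac row s := exists s; split;
  [ by rewrite /= ?inE; lia | by rewrite /=; lia
  | rewrite ?big_cons ?big_nil /ext_matrix; entry ].

Lemma prod_eq2 (p q : nat) : (p * q = 2)%N -> p = 1%N /\ q = 2%N \/ p = 2%N /\ q = 1%N.
Proof. by case: p q => [|[|[|p]]] [|[|[|q]]] //=; try lia; auto. Qed.

Lemma chain_affine_first p q x y n : (p * q = 2)%N -> (x * y = 2)%N -> (2 <= n)%N ->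
  affine_rows (ext_matrix (chain_matrix p q n) n 0 x y) n.+1
    (fun i => if i == n then y else if i == n.-1 then q else 2%N).
Proof.
move=> /prod_eq2 pq /prod_eq2 xy n2 i i_n _.
have [->|in0] := eqVneq i n; first by case: xy => [][-> ->]; row [:: 0]%N.
have [->|in1] := eqVneq i n.-1; first by case: pq => [][-> ->]; row [:: n.-2]%N.
have [->|i0] := eqVneq i 0%N.
  by case: pq => [][-> ->]; case: xy => [][-> ->]; row [:: n; 1]%N.
by case: pq => [][-> ->]; row [:: i.-1; i.+1]%N.
Qed.

Lemma chain_affine_middle p q n k : (p * q = 2)%N -> (0 < k)%N -> (k.+2 <= n)%N ->
  affine_rows (ext_matrix (chain_matrix p q n) n k 1 1) n.+1
    (fun i => if (i == n) || (i.+1 == k) then 1%N else if (i < k)%N then 0%N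
              else if i == n.-1 then q else 2%N).
Proof.
move=> /prod_eq2 pq k0 kn i i_n ci.
have [->|in0] := eqVneq i n; first by row [:: k].
have [->|ik1] := eqVneq i k.-1; first by row [:: k].
have {ci} ki : (k <= i)%N by move: ci; case: (leqP k i) => //; repeat decide_if; lia.
have [->|in1] := eqVneq i n.-1; first by case: pq => [][-> ->]; row [:: n.-2].
have [->|ik] := eqVneq i k; first by case: pq => [][-> ->]; row [:: n; k.-1; k.+1].
by case: pq => [][-> ->]; row [:: i.-1; i.+1].
Qed.

Lemma chain_affine_last p q x y n : (p * q = 2)%N -> (x * y = 2)%N -> (2 <= n)%N ->
  affine_rows (ext_matrix (chain_matrix p q n) n n.-1 x y) n.+1
    (fun i => if i == n then y else if i == n.-1 then 2%N else if i == n.-2 then p else 0%N).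
Proof.
move=> /prod_eq2 pq /prod_eq2 xy n2 i i_n ci.
have [->|in0] := eqVneq i n; first by case: xy => [][-> ->]; row [:: n.-1].
have [->|in1] := eqVneq i n.-1.
  by case: pq => [][-> ->]; case: xy => [][-> ->]; row [:: n; n.-2].
have -> : i = n.-2 by move: ci; repeat decide_if; lia.
by case: pq => [][-> ->]; row [:: n.-1].
Qed.

Lemma chain_affine_long p q n : (p * q = 2)%N -> (4 <= n)%N ->
  affine_rows (ext_matrix (chain_matrix p q n) n n.-1 1 1) n.+1
    (fun i => if i == n then q else if i == n.-1 then q.*2 else if (i.+4 < n)%N then 0%N
              else (i + 5 - n)%N).
Proof.
move=> /prod_eq2 pq n4 i i_n ci.
have [->|in0] := eqVneq i n; first by case: pq => [][-> ->]; row [:: n.-1].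
have [->|in1] := eqVneq i n.-1; first by case: pq => [][-> ->]; row [:: n; n.-2].
have [->|in2] := eqVneq i n.-2; first by case: pq => [][-> ->]; row [:: n.-1; (n - 3)%N].
have [->|in3] := eqVneq i (n - 3)%N; first by case: pq => [][-> ->]; row [:: n.-2; (n - 4)%N].
have -> : i = (n - 4)%N by move: ci; case: pq => [][_ ->]; repeat decide_if; lia.
by case: pq => [][-> ->]; row [:: (n - 3)%N].
Qed.

Lemma D_affine_first x y n : (x * y = 2)%N -> (5 <= n)%N ->
  affine_rows (ext_matrix (cartan_matrix (DynkinD n)) n 0 x y) n.+1
    (fun i => if i == n then y else if (n <= i.+2)%N then 1%N else 2%N).
Proof.
move=> /prod_eq2 xy n5 i i_n _.
have [->|in0] := eqVneq i n; first by case: xy => [][-> ->]; row [:: 0]%N.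
have [->|in1] := eqVneq i n.-1; first by row [:: (n - 3)%N].
have [->|in2] := eqVneq i n.-2; first by row [:: (n - 3)%N].
have [->|in3] := eqVneq i (n - 3)%N; first by row [:: (n - 4)%N; n.-2; n.-1].
have [->|i0] := eqVneq i 0%N; first by case: xy => [][-> ->]; row [:: n; 1]%N.
by row [:: i.-1; i.+1].
Qed.

Lemma D_affine_middle n k : (4 <= n)%N -> (0 < k)%N -> (k.+3 <= n)%N ->
  affine_rows (ext_matrix (cartan_matrix (DynkinD n)) n k 1 1) n.+1
    (fun i => if (i == n) || (i.+1 == k) then 1%N else if (i < k)%N then 0%N
              else if (n <= i.+2)%N then 1%N else 2%N).
Proof.
move=> n4 k0 kn i i_n ci.
have [->|in0] := eqVneq i n; first by row [:: k].
have [->|ik1] := eqVneq i k.-1; first by row [:: k].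
have {ci} ki : (k <= i)%N by move: ci; case: (leqP k i) => //; repeat decide_if; lia.
have [->|in1] := eqVneq i n.-1; first by row [:: (n - 3)%N].
have [->|in2] := eqVneq i n.-2; first by row [:: (n - 3)%N].
have [in3|in3] := eqVneq i (n - 3)%N.
  have [ik|ik] := eqVneq i k; first by row [:: n; k.-1; n.-2; n.-1].
  by row [:: i.-1; n.-2; n.-1].
have [->|ik] := eqVneq i k; first by row [:: n; k.-1; k.+1].
by row [:: i.-1; i.+1].
Qed.

Lemma D_affine_leaf x y n : (x * y = 2)%N -> (4 <= n)%N ->
  affine_rows (ext_matrix (cartan_matrix (DynkinD n)) n n.-1 x y) n.+1
    (fun i => if i == n then y else if (i == n.-1) || (i == n - 3)%N then 2%N
              else if (i == n.-2) || (i == n - 4)%N then 1%N else 0%N).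
Proof.
move=> /prod_eq2 xy n4 i i_n ci.
have [->|in0] := eqVneq i n; first by case: xy => [][-> ->]; row [:: n.-1].
have [->|in1] := eqVneq i n.-1; first by case: xy => [][-> ->]; row [:: n; (n - 3)%N].
have [->|in2] := eqVneq i n.-2; first by row [:: (n - 3)%N].
have [->|in3] := eqVneq i (n - 3)%N; first by row [:: (n - 4)%N; n.-2; n.-1].
have -> : i = (n - 4)%N by move: ci; repeat decide_if; lia.
by row [:: (n - 3)%N].
Qed.

Lemma D_affine_long n : (8 <= n)%N ->
  affine_rows (ext_matrix (cartan_matrix (DynkinD n)) n n.-1 1 1) n.+1
    (fun i => if i == n then 2%N else if i == n.-1 then 4%N else if i == n.-2 then 3%N
              else (i + 9 - n)%N).
Proof.
move=> n8 i i_n ci.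
have [->|in0] := eqVneq i n; first by row [:: n.-1].
have [->|in1] := eqVneq i n.-1; first by row [:: n; (n - 3)%N].
have [->|in2] := eqVneq i n.-2; first by row [:: (n - 3)%N].
have [->|in3] := eqVneq i (n - 3)%N; first by row [:: (n - 4)%N; n.-2; n.-1].
have [->|in8] := eqVneq i (n - 8)%N; first by row [:: (n - 7)%N].
have {ci} ? : (n - 8 < i)%N by move: ci; repeat decide_if; lia.
by row [:: i.-1; i.+1].
Qed.

(* C_2 is excluded because it is B_2. *)
Definition valid X : bool :=
  match X with
  | DynkinB n => 2 <= n
  | DynkinC n => 3 <= n
  | DynkinD n => 4 <= n
  | DynkinE n => 6 <= n <= 8
  | DynkinF4 | DynkinG2 => true
  end%N.

(* The connected diagrams of valid type X containing one of valid type Y. *)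
Definition reach Y X : bool :=
  match Y, X with
  | DynkinB m, DynkinB n => m <= n
  | DynkinB m, DynkinC n => m == 2
  | DynkinB m, DynkinF4 => m <= 3
  | DynkinC m, DynkinC n => m <= n
  | DynkinC m, DynkinF4 => m == 3
  | DynkinD m, DynkinD n => m <= n
  | DynkinD m, DynkinE n => m < n
  | DynkinE m, DynkinE n => m <= n
  | DynkinF4, DynkinF4 | DynkinG2, DynkinG2 => true
  | _, _ => false
  end%N.

Definition step Y X : bool :=
  match Y, X with
  | DynkinB m, DynkinB n | DynkinC m, DynkinC n | DynkinD m, DynkinD n => n == m.+1
  | DynkinB m, DynkinC n => (m == 2) && (n == 3)
  | DynkinB m, DynkinF4 | DynkinC m, DynkinF4 => m == 3
  | DynkinD m, DynkinE n | DynkinE m, DynkinE n => (n == m.+1) && (5 < n <= 8)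
  | _, _ => false
  end%N.

Lemma valid_step Y X : valid Y -> step Y X -> valid X.
Proof. by case: Y X => [m|m|m|m||] [n|n|n|n||] //=; lia. Qed.

Lemma reach_step Z Y X : valid Z -> valid Y -> reach Z Y -> step Y X -> reach Z X.
Proof.
by case: Z Y X => [k|k|k|k||] [m|m|m|m||] [n|n|n|n||] //=; lia.
Qed.

Lemma reach_refl X : reach X X.
Proof. by case: X => //= *; lia. Qed.

Section Step.
Variables (R : realFieldType) (V : vectType R) (Phi : root_system V).
Implicit Types (a b r u v : Phi) (I J K D S : {set Phi}) (f g : nat -> Phi).

Definition has_type X K : Prop :=
  exists f, diagram (rank X) (cartan_matrix X) f K.

Variables (D : {set Phi}) (baseD : is_base D).

Lemma no_affine_ext n M i0 x y x' y' g K c : diagram n.+1 (ext_matrix M n i0 x y) g K ->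
  K \subset D -> (x' <= x)%N -> (y' <= y)%N ->
  affine_rows (ext_matrix M n i0 x' y') n.+1 c ->
  forall i, (i < n.+1)%N -> c i = 0%N.
Proof.
move=> dK KD xx yy rows.
apply: (no_affine_diagram (A := fun i j => `|ext_matrix M n i0 x' y' i j|%N) baseD dK KD) => //.
by move=> i j _ _ _; rewrite /ext_matrix; repeat (case: ifP => _) => //; lia.
Qed.

Lemma no_affine_ext_seq n M i0 x y x' y' g K c : diagram n.+1 (ext_matrix M n i0 x y) g K ->
  K \subset D -> (x' <= x)%N -> (y' <= y)%N -> size c = n.+1 ->
  affine_check (fun i j => `|ext_matrix M n i0 x' y' i j|%N) c -> False.
Proof.
move=> dK KD xx yy; apply: (no_affine_seq baseD dK KD).
by move=> i j _ _ _; rewrite /ext_matrix; repeat (case: ifP => _) => //; lia.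
Qed.

Lemma bond_cases x y : (0 < x)%N -> (0 < y)%N ->
  x = 1%N /\ y = 1%N \/
  exists x' y', [/\ (x' <= x)%N, (y' <= y)%N & (x' * y' = 2)%N].
Proof.
move=> x0 y0; have [x1|x1] := leqP x 1; have [y1|y1] := leqP y 1.
- by left; lia.
- by right; exists 1%N, 2%N.
- by right; exists 2%N, 1%N.
- by right; exists 1%N, 2%N.
Qed.

Definition front n i := if i is j.+1 then j else n.

Lemma front_relabel n M M' g K : diagram n.+1 M g K ->
  (forall i j, (i < n.+1)%N -> (j < n.+1)%N -> M' i j = M (front n i) (front n j)) ->
  diagram n.+1 M' (g \o front n) K.
Proof.
move=> dK; apply: (diagram_relabel dK) => [[|i] //=|[|i] [|j]] //=.
- exact: leqW.
- by rewrite !inE; lia.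
- by rewrite !inE; lia.
- by move=> _ _ ->.
Qed.

Section Extension.
Variables (n i0 x y : nat) (g : nat -> Phi) (K : {set Phi}).
Hypotheses (i0n : (i0 < n)%N) (x_gt0 : (0 < x)%N) (y_gt0 : (0 < y)%N) (KD : K \subset D).

Lemma chain_step p q : (p * q = 2)%N -> (2 <= n)%N ->
  diagram n.+1 (ext_matrix (chain_matrix p q n) n i0 x y) g K ->
  [\/ exists f, diagram n.+1 (chain_matrix p q n.+1) f K,
      n = 2 /\ exists f, diagram 3 (chain_matrix q p 3) f K |
      n = 3 /\ has_type DynkinF4 K].
Proof.
move=> pq n2 dK; have nn : (n < n.+1)%N by [].
have [i0_first|i0_pos] := posnP i0.
  subst i0; have [[x1 y1]|[x' [y' [xx yy xy]]]] := bond_cases x_gt0 y_gt0; last first.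
    have := no_affine_ext dK KD xx yy (chain_affine_first pq xy n2) nn.
    by rewrite eqxx; lia.
  subst x y; apply: Or31; exists (g \o front n); apply: (front_relabel dK).
  by move=> [|i] [|j] /= i_n j_n; rewrite /ext_matrix; entry.
have [i0_last|i0_nlast] := eqVneq i0 n.-1; last first.
  have kn : (i0.+2 <= n)%N by lia.
  have := no_affine_ext dK KD x_gt0 y_gt0 (chain_affine_middle pq i0_pos kn) nn.
  by rewrite eqxx.
subst i0; have [[x1 y1]|[x' [y' [xx yy xy]]]] := bond_cases x_gt0 y_gt0; last first.
  have := no_affine_ext dK KD xx yy (chain_affine_last pq xy n2) nn.
  by rewrite eqxx; lia.
have [n4|n4] := leqP 4 n.
  have := no_affine_ext dK KD x_gt0 y_gt0 (chain_affine_long pq n4) nn.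
  by rewrite eqxx; lia.
have [n_2|n_3] : n = 2%N \/ n = 3%N by lia.
  subst x y n; apply: Or32; split=> //; exists (g \o nth 0%N [:: 2; 1; 0]%N).
  by apply: (diagram_relabel_seq dK); case: (prod_eq2 pq) => [][-> ->].
subst x y n; apply: Or33; split=> //; case: (prod_eq2 pq) dK => [][-> ->] dK.
  by exists (g \o nth 0%N [:: 3; 2; 1; 0]%N); apply: (diagram_relabel_seq dK).
by exists (g \o nth 0%N [:: 0; 1; 2; 3]%N); apply: (diagram_relabel_seq dK).
Qed.

Lemma D_step_normal : (4 <= n)%N -> i0 != n.-2 -> (n == 4) ==> (i0 != 0%N) ->
  diagram n.+1 (ext_matrix (cartan_matrix (DynkinD n)) n i0 x y) g K ->
  exists2 X, step (DynkinD n) X & has_type X K.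
Proof.
move=> n4 i0n2 i04 dK; have nn : (n < n.+1)%N by [].
have [i0_first|i0_pos] := posnP i0.
  subst i0; have n5 : (5 <= n)%N by move: i04; lia.
  have [[x1 y1]|[x' [y' [xx yy xy]]]] := bond_cases x_gt0 y_gt0; last first.
    have := no_affine_ext dK KD xx yy (D_affine_first xy n5) nn.
    by rewrite eqxx; lia.
  subst x y; exists (DynkinD n.+1); first by rewrite /= eqxx.
  exists (g \o front n); apply: (front_relabel dK).
  by move=> [|i] [|j] /= i_n j_n; rewrite /ext_matrix; entry.
have [i0_last|i0_nlast] := eqVneq i0 n.-1; last first.
  have kn : (i0.+3 <= n)%N by lia.
  have := no_affine_ext dK KD x_gt0 y_gt0 (D_affine_middle n4 i0_pos kn) nn.
  by rewrite eqxx.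
subst i0; have [[x1 y1]|[x' [y' [xx yy xy]]]] := bond_cases x_gt0 y_gt0; last first.
  have := no_affine_ext dK KD xx yy (D_affine_leaf xy n4) nn.
  by rewrite eqxx; lia.
have [n8|n8] := leqP 8 n.
  have := no_affine_ext dK KD x_gt0 y_gt0 (D_affine_long n8) nn.
  by rewrite eqxx; lia.
have [n_4|[n_5|[n_6|n_7]]] : n = 4%N \/ n = 5%N \/ n = 6%N \/ n = 7%N by lia.
- subst x y n; exists (DynkinD 5) => //.
  by exists (g \o nth 0%N [:: 4; 3; 1; 0; 2]%N); apply: (diagram_relabel_seq dK).
- subst x y n; exists (DynkinE 6) => //.
  by exists (g \o nth 0%N [:: 5; 3; 4; 2; 1; 0]%N); apply: (diagram_relabel_seq dK).
- subst x y n; exists (DynkinE 7) => //.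
  by exists (g \o nth 0%N [:: 6; 4; 5; 3; 2; 1; 0]%N); apply: (diagram_relabel_seq dK).
- subst x y n; exists (DynkinE 8) => //.
  by exists (g \o nth 0%N [:: 7; 5; 6; 4; 3; 2; 1; 0]%N); apply: (diagram_relabel_seq dK).
Qed.

End Extension.

Lemma D_step n i0 x y g K : (i0 < n)%N -> (0 < x)%N -> (0 < y)%N -> K \subset D ->
  (4 <= n)%N -> diagram n.+1 (ext_matrix (cartan_matrix (DynkinD n)) n i0 x y) g K ->
  exists2 X, step (DynkinD n) X & has_type X K.
Proof.
move=> i0n x0 y0 KD n4 dK; have [i0n2|i0n2] := eqVneq i0 n.-2.
  pose t i := if i == n.-2 then n.-1 else if i == n.-1 then n.-2 else i.
  have dK' : diagram n.+1 (ext_matrix (cartan_matrix (DynkinD n)) n n.-1 x y) (g \o t) K.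
    apply: (diagram_relabel dK) => [i|i j|i j].
    + by rewrite /t; repeat decide_if; lia.
    + by rewrite !inE /t => _ _; repeat decide_if; lia.
    + have t2 : t n.-2 = n.-1 by rewrite /t eqxx.
      have t1 : t n.-1 = n.-2 by rewrite /t eqxx; entry.
      have t0 k : k != n.-2 -> k != n.-1 -> t k = k by rewrite /t => /negPf-> /negPf->.
      rewrite i0n2; move: t1 t2 t0 => {dK i0n x0 y0 i0n2}; move: t => t t1 t2 t0 i_n j_n.
      have [->|i2] := eqVneq i n.-2; [rewrite t2|have [->|i1] := eqVneq i n.-1;
        [rewrite t1|rewrite (t0 i i2 i1)]];
      (have [->|j2] := eqVneq j n.-2; [rewrite t2|have [->|j1] := eqVneq j n.-1;
        [rewrite t1|rewrite (t0 j j2 j1)]]); clear t t1 t2 t0; rewrite /ext_matrix; entry.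
  by apply: D_step_normal dK' => //; lia.
have [/andP[/eqP n_4 /eqP i00]|ni0] := boolP ((n == 4) && (i0 == 0%N)); last first.
  by apply: D_step_normal dK => //; move: ni0; rewrite negb_and implybE.
subst n i0.
have dK' : diagram 5 (ext_matrix (cartan_matrix (DynkinD 4)) 4 3 x y)
    (g \o nth 0%N [:: 3; 1; 2; 0; 4]%N) K.
  by apply: (diagram_relabel_seq dK); rewrite /ext_matrix /= !eqxx.
by apply: D_step_normal dK'.
Qed.

Lemma single_bond n M i0 x y g K c : (0 < x)%N -> (0 < y)%N -> K \subset D ->
  diagram n.+1 (ext_matrix M n i0 x y) g K -> size c = n ->
  affine_check (fun i j => `|ext_matrix M n i0 1 2 i j|%N) (rcons c 2) ->
  affine_check (fun i j => `|ext_matrix M n i0 2 1 i j|%N) (rcons c 1) -> x = 1%N /\ y = 1%N.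
Proof.
move=> x0 y0 KD dK sc c12 c21.
have [//|[x' [y' [xx yy /prod_eq2[][x'E y'E]]]]] := bond_cases x0 y0; subst x' y'.
  by case: (no_affine_ext_seq (c := rcons c 2) dK KD xx yy); rewrite ?size_rcons ?sc.
by case: (no_affine_ext_seq (c := rcons c 1) dK KD xx yy); rewrite ?size_rcons ?sc.
Qed.

Lemma no_extension n M i0 x y g K c : (0 < x)%N -> (0 < y)%N -> K \subset D ->
  diagram n.+1 (ext_matrix M n i0 x y) g K -> size c = n.+1 ->
  affine_check (fun i j => `|ext_matrix M n i0 1 1 i j|%N) c -> False.
Proof. by move=> x0 y0 KD dK; apply: no_affine_ext_seq dK KD x0 y0. Qed.

Lemma E_step n i0 x y g K : (i0 < n)%N -> (0 < x)%N -> (0 < y)%N -> K \subset D ->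
  (6 <= n <= 8)%N -> diagram n.+1 (ext_matrix (cartan_matrix (DynkinE n)) n i0 x y) g K ->
  exists2 X, step (DynkinE n) X & has_type X K.
Proof.
move=> i0n x0 y0 KD n68 dK.
have [n_6|[n_7|n_8]] : n = 6%N \/ n = 7%N \/ n = 8%N by lia.
- subst n; move: i0n dK.
  case: i0 => [_|[_|[_|[_|[_|[_|//]]]]]] dK.
  + have [|//|//|x1 y1] := single_bond (c := [:: 2; 1; 2; 2; 1; 0]%N) x0 y0 KD dK; first by [].
    subst x y; exists (DynkinE 7) => //.
    by exists (g \o nth 0%N [:: 5; 1; 4; 3; 2; 0; 6]%N); apply: (diagram_relabel_seq dK).
  + by case: (no_extension (c := [:: 1; 2; 2; 3; 2; 1; 1]%N) x0 y0 KD dK) => //; vm_compute.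
  + by case: (no_extension (c := [:: 1; 1; 2; 2; 1; 0; 1]%N) x0 y0 KD dK) => //; vm_compute.
  + by case: (no_extension (c := [:: 0; 1; 1; 2; 1; 0; 1]%N) x0 y0 KD dK) => //; vm_compute.
  + by case: (no_extension (c := [:: 0; 1; 1; 2; 2; 1; 1]%N) x0 y0 KD dK) => //; vm_compute.
  + have [|//|//|x1 y1] := single_bond (c := [:: 0; 1; 1; 2; 2; 2]%N) x0 y0 KD dK; first by [].
    subst x y; exists (DynkinE 7) => //.
    by exists (g \o nth 0%N [:: 0; 1; 2; 3; 4; 5; 6]%N); apply: (diagram_relabel_seq dK).
- subst n; move: i0n dK.
  case: i0 => [_|[_|[_|[_|[_|[_|[_|//]]]]]]] dK.
  + by case: (no_extension (c := [:: 2; 2; 3; 4; 3; 2; 1; 1]%N) x0 y0 KD dK) => //; vm_compute.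
  + by case: (no_extension (c := [:: 1; 2; 2; 3; 2; 1; 0; 1]%N) x0 y0 KD dK) => //; vm_compute.
  + by case: (no_extension (c := [:: 1; 1; 2; 2; 1; 0; 0; 1]%N) x0 y0 KD dK) => //; vm_compute.
  + by case: (no_extension (c := [:: 0; 1; 1; 2; 1; 0; 0; 1]%N) x0 y0 KD dK) => //; vm_compute.
  + by case: (no_extension (c := [:: 0; 1; 1; 2; 2; 1; 0; 1]%N) x0 y0 KD dK) => //; vm_compute.
  + by case: (no_extension (c := [:: 0; 1; 1; 2; 2; 2; 1; 1]%N) x0 y0 KD dK) => //; vm_compute.
  + have [|//|//|x1 y1] := single_bond (c := [:: 0; 1; 1; 2; 2; 2; 2]%N) x0 y0 KD dK; first by [].
    subst x y; exists (DynkinE 8) => //.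
    by exists (g \o nth 0%N [:: 0; 1; 2; 3; 4; 5; 6; 7]%N); apply: (diagram_relabel_seq dK).
- subst n; move: i0n dK.
  case: i0 => [_|[_|[_|[_|[_|[_|[_|[_|//]]]]]]]] dK.
  + by case: (no_extension (c := [:: 2; 2; 3; 4; 3; 2; 1; 0; 1]%N) x0 y0 KD dK) => //; vm_compute.
  + by case: (no_extension (c := [:: 1; 2; 2; 3; 2; 1; 0; 0; 1]%N) x0 y0 KD dK) => //; vm_compute.
  + by case: (no_extension (c := [:: 1; 1; 2; 2; 1; 0; 0; 0; 1]%N) x0 y0 KD dK) => //; vm_compute.
  + by case: (no_extension (c := [:: 0; 1; 1; 2; 1; 0; 0; 0; 1]%N) x0 y0 KD dK) => //; vm_compute.
  + by case: (no_extension (c := [:: 0; 1; 1; 2; 2; 1; 0; 0; 1]%N) x0 y0 KD dK) => //; vm_compute.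
  + by case: (no_extension (c := [:: 0; 1; 1; 2; 2; 2; 1; 0; 1]%N) x0 y0 KD dK) => //; vm_compute.
  + by case: (no_extension (c := [:: 0; 1; 1; 2; 2; 2; 2; 1; 1]%N) x0 y0 KD dK) => //; vm_compute.
  + by case: (no_extension (c := [:: 2; 3; 4; 6; 5; 4; 3; 2; 1]%N) x0 y0 KD dK) => //; vm_compute.
Qed.

Lemma F4_step i0 x y g K : (i0 < 4)%N -> (0 < x)%N -> (0 < y)%N -> K \subset D ->
  diagram 5 (ext_matrix (cartan_matrix DynkinF4) 4 i0 x y) g K -> False.
Proof.
move=> + x0 y0 KD.
case: i0 => [_|[_|[_|[_|//]]]] dK.
- by case: (no_extension (c := [:: 2; 3; 2; 1; 1]%N) x0 y0 KD dK) => //; vm_compute.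
- by case: (no_extension (c := [:: 1; 2; 1; 0; 1]%N) x0 y0 KD dK) => //; vm_compute.
- by case: (no_extension (c := [:: 0; 2; 2; 1; 1]%N) x0 y0 KD dK) => //; vm_compute.
- by case: (no_extension (c := [:: 2; 4; 3; 2; 1]%N) x0 y0 KD dK) => //; vm_compute.
Qed.

Lemma G2_step i0 x y g K : (i0 < 2)%N -> (0 < x)%N -> (0 < y)%N -> K \subset D ->
  diagram 3 (ext_matrix (cartan_matrix DynkinG2) 2 i0 x y) g K -> False.
Proof.
move=> + x0 y0 KD.
case: i0 => [_|[_|//]] dK.
- by case: (no_extension (c := [:: 2; 3; 1]%N) x0 y0 KD dK) => //; vm_compute.
- by case: (no_extension (c := [:: 1; 2; 1]%N) x0 y0 KD dK) => //; vm_compute.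
Qed.

Lemma diagram_eqM n M M' f K : diagram n M f K ->
  (forall i j, (i < n)%N -> (j < n)%N -> M' i j = M i j) -> diagram n M' f K.
Proof. by case=> finj Kf fM MM'; split=> // i j ? ?; rewrite MM' // fM. Qed.

Lemma type_step X i0 x y g K : valid X -> (i0 < rank X)%N -> (0 < x)%N -> (0 < y)%N ->
  K \subset D -> diagram (rank X).+1 (ext_matrix (cartan_matrix X) (rank X) i0 x y) g K ->
  exists2 X', step X X' & has_type X' K.
Proof.
have extE n M M' : M =2 M' -> diagram n.+1 (ext_matrix M n i0 x y) g K ->
    diagram n.+1 (ext_matrix M' n i0 x y) g K.
  by move=> MM' /diagram_eqM; apply=> i j _ _; rewrite /ext_matrix MM'.
case: X => [n|n|n|n||] /= vX i0n x0 y0 KD dK.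
- have dK' := extE _ _ _ (@chain_matrixB n) dK.
  case: (chain_step i0n x0 y0 KD (erefl : (2 * 1 = 2)%N) vX dK').
  + move=> [f df]; exists (DynkinB n.+1); rewrite /= ?eqxx //; exists f.
    by apply: (diagram_eqM df) => i j _ _; rewrite chain_matrixB.
  + move=> [-> [f df]]; exists (DynkinC 3) => //; exists f.
    by apply: (diagram_eqM df) => i j _ _; rewrite chain_matrixC.
  + by move=> [-> tK]; exists DynkinF4.
- have dK' := extE _ _ _ (@chain_matrixC n) dK.
  case: (chain_step i0n x0 y0 KD (erefl : (1 * 2 = 2)%N) (ltnW vX) dK').
  + move=> [f df]; exists (DynkinC n.+1); rewrite /= ?eqxx //; exists f.
    by apply: (diagram_eqM df) => i j _ _; rewrite chain_matrixC.
  + by move=> [n2 _]; move: vX; rewrite n2.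
  + by move=> [-> tK]; exists DynkinF4.
- exact: D_step dK.
- exact: E_step dK.
- by case: (F4_step i0n x0 y0 KD dK).
- by case: (G2_step i0n x0 y0 KD dK).
Qed.

Lemma rank_gt0 X : valid X -> (0 < rank X)%N.
Proof. by case: X => [n|n|n|n||] //=; lia. Qed.

Lemma grow Y K S : valid Y -> has_type Y K -> connected K -> K \subset S ->
  connected S -> S \subset D -> exists X, [/\ valid X, reach Y X & has_type X S].
Proof.
move=> vY tK conK KS conS SD.
apply: (growth_ind (P := fun J => exists X, [/\ valid X, reach Y X & has_type X J]) SD conS KS conK).
  by exists Y; split=> //; exact: reach_refl.
move=> J v JS conJ [X [vX rX [f df]]] vS vJ uJ.
have [i0 [x [y [i0n x0 y0 _ [g dg]]]]] := attach baseD df conJ (subset_trans JS SD) (subsetP SD v vS) vJ uJ.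
have vJD : v |: J \subset D.
  by rewrite subUset sub1set (subsetP SD v vS) (subset_trans JS SD).
have [X' sX tX'] := type_step vX i0n x0 y0 vJD dg.
exists X'; split=> //; first exact: valid_step sX.
exact: reach_step vY vX rX sX.
Qed.

Lemma diagram_star n M f J c : diagram n M f J -> (c < n)%N ->
  (forall i, (i < n)%N -> i != c -> M c i != 0) -> connected J.
Proof.
move=> [_ Jf fM] cn Mc; have cJ : f c \in J by rewrite Jf mem_img // mem_iota.
have cE a : a \in J -> connect (adjacent J) (f c) a.
  move=> aJ; have := aJ; rewrite {1}Jf => /imgP[i]; rewrite mem_iota => i_n aE.
  have [ac|ac] := eqVneq a (f c); first by rewrite ac.
  apply: connect1; rewrite adjacentE cJ aJ eq_sym ac aE mult_gt0 fM //.
  by apply: Mc => //; apply: contraNneq ac => <-; rewrite aE.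
split; first by apply/set0Pn; exists (f c).
move=> a b aJ bJ; apply: connect_trans (cE b bJ).
by rewrite (sym_connect_sym (@adjacent_sym _ _ _ _)) cE.
Qed.

Definition has_core K : Prop :=
  exists X J, [/\ valid X, has_type X J, J \subset K & connected J].

Lemma core_sub X n M g K (t : seq nat) c : valid X -> diagram n M g K ->
  size t = rank X -> all (gtn n) t -> uniq t ->
  (forall i j, (i < rank X)%N -> (j < rank X)%N ->
    cartan_matrix X i j = M (nth 0 t i)%N (nth 0 t j)%N) ->
  (c < rank X)%N -> (forall i, (i < rank X)%N -> i != c -> cartan_matrix X c i != 0) ->
  has_core K.
Proof.
move=> vX dK st /allP tn ut tM cX star.
have [||dJ JK] := diagram_sub (m := rank X) (M' := cartan_matrix X) (t := nth 0%N t) dK _ _ tM.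
- by move=> i iX; apply: tn; rewrite mem_nth // st.
- by move=> i j; rewrite !inE -st => i_n j_n /eqP; rewrite nth_uniq // => /eqP.
exists X; eexists; split; [by []|eexists; exact: dJ|exact: JK|].
exact: diagram_star dJ cX star.
Qed.

Lemma chainA_step n i0 x y g K : (i0 < n)%N -> (0 < x)%N -> (0 < y)%N -> (x * y <= 3)%N ->
  K \subset D -> diagram n.+1 (ext_matrix (simply_laced chain) n i0 x y) g K ->
  (exists f, diagram n.+1 (simply_laced chain) f K) \/ has_core K.
Proof.
move=> i0n x0 y0 xy KD dK.
have ni0 : ([:: n; i0] == [:: i0; n]) = false by rewrite eqseq_cons; lia.
have pair X t : valid X -> rank X = 2%N -> t = [:: i0; n] \/ t = [:: n; i0] ->
    cartan_matrix X 0 0 = 2 -> cartan_matrix X 1 1 = 2 ->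
    cartan_matrix X 0 1 = (if t == [:: i0; n] then - x%:Z else - y%:Z) ->
    cartan_matrix X 1 0 = (if t == [:: i0; n] then - y%:Z else - x%:Z) -> has_core K.
  move=> vX rX tE X00 X11 X01 X10.
  apply: (@core_sub X _ _ _ _ t 0%N vX dK); rewrite ?rX //.
  - by case: tE => ->.
  - by case: tE => ->; rewrite /=; lia.
  - by case: tE => ->; rewrite /= inE; lia.
  - move=> [|[|i]] [|[|j]] //= _ _; rewrite ?X00 ?X11 ?X01 ?X10; case: tE => ->;
      rewrite ?eqxx ?ni0 /= /ext_matrix; entry.
  - by move=> [|[|i]] // _ _; rewrite X01; case: ifP => _; lia.
have [[x1 y1]|[[x1 y1]|[[x1 y1]|[[x1 y1]|[x1 y1]]]]] : (x = 1 /\ y = 1 \/ x = 1 /\ y = 2 \/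
    x = 2 /\ y = 1 \/ x = 1 /\ y = 3 \/ x = 3 /\ y = 1)%N by nia.
- subst x y; have [i00|i0_pos] := posnP i0.
    subst i0; left; exists (g \o front n); apply: (front_relabel dK).
    by move=> [|i] [|j] /= i_n j_n; rewrite /ext_matrix; entry.
  have [i0_last|i0_nlast] := eqVneq i0 n.-1.
    left; exists g; apply: (diagram_eqM dK) => i j i_n j_n.
    by rewrite i0_last /ext_matrix; entry.
  right; apply: (@core_sub (DynkinD 4) _ _ _ _ [:: i0.-1; i0; i0.+1; n] 1 _ dK) => //.
  + by rewrite /=; lia.
  + by rewrite /= !inE; lia.
  + move=> i j i4 j4; clear dK pair ni0 xy x0 y0.
    have nE k (l : seq nat) : (k < 4)%N -> k \in [:: 0; 1; 2; 3]%N by rewrite !inE; lia.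
    move: (nE i [::] i4) (nE j [::] j4); rewrite !inE.
    by case/or4P=> /eqP->; case/or4P=> /eqP->; rewrite /= /ext_matrix; entry.
  + by case=> [|[|[|[|]]]].
- right; apply: (pair (DynkinB 2) [:: n; i0]) => //; rewrite ?ni0 ?x1 ?y1; auto.
- right; apply: (pair (DynkinB 2) [:: i0; n]) => //; rewrite ?eqxx ?x1 ?y1; auto.
- right; apply: (pair DynkinG2 [:: i0; n]) => //; rewrite ?eqxx ?x1 ?y1; auto.
- right; apply: (pair DynkinG2 [:: n; i0]) => //; rewrite ?ni0 ?x1 ?y1; auto.
Qed.

Lemma classification S : S \subset D -> connected S ->
  (exists n f, diagram n (simply_laced chain) f S) \/
  exists2 X, valid X & has_type X S.
Proof.
move=> SD conS; have [/set0Pn[a aS] _] := conS.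
have con1 : connected [set a].
  by split=> [|b c /set1P-> /set1P->]; [apply/set0Pn; exists a; rewrite set11|].
have sub1 : [set a] \subset S by rewrite sub1set.
suff [chainS|[X [J [vX tX JS conJ]]]] : (exists n f, diagram n (simply_laced chain) f S) \/ has_core S.
- by left.
- by right; have [X' [vX' _ tX']] := grow vX tX conJ JS conS SD; exists X'.
apply: (growth_ind (P := fun J => (exists n f, diagram n (simply_laced chain) f J) \/ has_core J)
  SD conS sub1 con1).
  left; exists 1%N, (fun=> a); split=> [[|i] [|j] //||[|i] [|j] // _ _].
  - by rewrite img_cons img_nil setU0.
  - by rewrite cartan_diag.
move=> J v JS conJ [[n [f df]]|[X [J' [vX tX J'J conJ']]]] vS vJ uJ; last first.
  by right; exists X, J'; split=> //; apply: subset_trans J'J _; exact: subsetUr.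
have [i0 [x [y [i0n x0 y0 xy [g dg]]]]] := attach baseD df conJ (subset_trans JS SD) (subsetP SD v vS) vJ uJ.
have vJD : v |: J \subset D.
  by rewrite subUset sub1set (subsetP SD v vS) (subset_trans JS SD).
case: (chainA_step i0n x0 y0 xy vJD dg) => [[h dh]|]; last by right.
by left; exists n.+1, h.
Qed.

End Step.

Definition neg_type X : bool :=
  match X with
  | DynkinD n => ~~ odd n
  | DynkinE n => n != 6
  | _ => true
  end.

(* The branch vertex, or one end of the multiple edge. *)
Definition centre X : nat :=
  match X with
  | DynkinB n | DynkinC n => n.-1
  | DynkinD n => n - 3
  | DynkinE _ => 3
  | DynkinF4 => 2
  | DynkinG2 => 0
  end%N.

Lemma two_neighbours X i : valid X -> (i < rank X)%N -> i != centre X ->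
  exists p q, forall j, (j < rank X)%N -> j != i -> cartan_matrix X i j != 0 ->
  (j == p) || (j == q).
Proof.
case: X => [n|n|n|n||] /= vX i_n ic.
- exists i.-1, i.+1 => j j_n ji; rewrite -/(cartan_matrix (DynkinB n) i j) chain_matrixB.
  by apply: contraR => ?; apply/eqP; entry.
- exists i.-1, i.+1 => j j_n ji; rewrite -/(cartan_matrix (DynkinC n) i j) chain_matrixC.
  by apply: contraR => ?; apply/eqP; entry.
- have [i1|i1] := eqVneq i n.-1.
    by exists (n - 3)%N, (n - 3)%N => j j_n ji; apply: contraR => ?; apply/eqP; entry.
  by exists i.-1, i.+1 => j j_n ji; apply: contraR => ?; apply/eqP; entry.
- exists (nth 0 [:: 2; 3; 0; 0; 3; 4; 5; 6] i)%N, (nth 0 [:: 2; 3; 3; 0; 5; 6; 7; 6] i)%N.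
  have {i_n} i8 : (i < 8)%N by lia.
  move=> j j_n; have {j_n vX} j8 : (j < 8)%N by lia.
  by case: i i8 ic => [|[|[|[|[|[|[|[|]]]]]]]] // _ _;
     case: j j8 => [|[|[|[|[|[|[|[|]]]]]]]].
- exists i.-1, i.+1 => j j_n.
  by case: i i_n ic => [|[|[|[|]]]] // _ _; case: j j_n => [|[|[|[|]]]].
- exists i.-1, i.+1 => j j_n.
  by case: i i_n ic => [|[|]] // _ _; case: j j_n => [|[|]].
Qed.

Lemma three_neighbours_centre X i j1 j2 j3 : valid X -> (i < rank X)%N ->
  all (fun j => [&& j < rank X, j != i & cartan_matrix X i j != 0])%N [:: j1; j2; j3] ->
  uniq [:: j1; j2; j3] -> i = centre X.
Proof.
move=> vX iX /and4P[/and3P[n1 i1 m1] /and3P[n2 i2 m2] /and3P[n3 i3 m3] _] uj.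
apply/eqP; have [//|/(two_neighbours vX iX)[p [q pq]]] := eqVneq.
by move: (pq j1 n1 i1 m1) (pq j2 n2 i2 m2) (pq j3 n3 i3 m3) uj; rewrite /= !inE; lia.
Qed.

Lemma multiple_bond_centre X i j : valid X -> (i < rank X)%N -> (j < rank X)%N -> i != j ->
  1 < cartan_matrix X i j * cartan_matrix X j i -> i = centre X \/ j = centre X.
Proof.
case: X => [n|n|n|n||] /= vX i_n j_n ij.
- rewrite -!/(cartan_matrix (DynkinB n) _ _) !chain_matrixB.
  by entry.
- rewrite -!/(cartan_matrix (DynkinC n) _ _) !chain_matrixC.
  by entry.
- by rewrite /simply_laced (eq_sym j i) (negPf ij); do 2 case: ifP.
- by rewrite /simply_laced (eq_sym j i) (negPf ij); do 2 case: ifP.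
- by move: i_n j_n ij; case: i => [|[|[|[|]]]] //; case: j => [|[|[|[|]]]] //; auto.
- by move: i_n j_n ij; case: i => [|[|]] //; case: j => [|[|]] //; auto.
Qed.

Lemma chain_multiple_bond p q n i j : (i < n)%N -> (j < n)%N -> i != j ->
  1 < chain_matrix p q n i j * chain_matrix p q n j i ->
  (i == n.-2) && (j == n.-1) || (i == n.-1) && (j == n.-2).
Proof. by move=> i_n j_n ij; entry. Qed.

Section Subdiagrams.
Variables (R : realFieldType) (V : vectType R) (Phi : root_system V).
Implicit Types (a b r u v : Phi) (I J K D S : {set Phi}) (f g : nat -> Phi).

Lemma diagram_index n M f K a : diagram n M f K -> a \in K -> exists2 i, (i < n)%N & a = f i.
Proof. by case=> _ -> _ /imgP[i]; rewrite mem_iota => i_n ->; exists i. Qed.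

Lemma diagram_mem n M f K i : diagram n M f K -> (i < n)%N -> f i \in K.
Proof. by case=> _ -> _ i_n; rewrite mem_img // mem_iota. Qed.

Lemma diagram_eq n M f K i j : diagram n M f K -> (i < n)%N -> (j < n)%N ->
  (f i == f j) = (i == j).
Proof. by case=> finj _ _ i_n j_n; apply/eqP/eqP => [/finj->|->]. Qed.

Lemma sub_diagram_index n M f D m M' g K : diagram n M f D -> diagram m M' g K -> K \subset D ->
  exists h, [/\ forall i, (i < m)%N -> (h i < n)%N /\ g i = f (h i),
     forall i j, (i < m)%N -> (j < m)%N -> (h i == h j) = (i == j) &
     forall i j, (i < m)%N -> (j < m)%N -> M' i j = M (h i) (h j)].
Proof.
move=> df dg KD; pose h i := index (g i) (map f (iota 0 n)).
have hP i : (i < m)%N -> (h i < n)%N /\ g i = f (h i).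
  move=> im; have := subsetP KD _ (diagram_mem dg im).
  have [_ -> _] := df; rewrite inE => gi.
  have hn : (h i < n)%N by rewrite -[n](size_iota 0) -(size_map f) index_mem.
  by split=> //; rewrite -{1}(nth_index (g i) gi) (nth_map 0%N) ?size_iota // nth_iota.
exists h; split=> // i j im jm; have [hi gi] := hP i im; have [hj gj] := hP j jm.
  by rewrite -(diagram_eq dg im jm) gi gj (diagram_eq df).
by have [_ _ <-] := dg => //; have [_ _ <-] := df => //; rewrite gi gj.
Qed.

(* Each type has a branch vertex or a multiple edge, which can only be at the
   centre of a diagram containing it. *)
Lemma centre_mem X Y f D K : valid X -> valid Y ->
  diagram (rank X) (cartan_matrix X) f D -> has_type Y K -> K \subset D ->
  f (centre X) \in K.
Proof.
move=> vX vY df [g dg] KD; have [h [hP hI hM]] := sub_diagram_index df dg KD.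
have gE i : (i < rank Y)%N -> f (h i) \in K.
  by move=> iY; have [_ <-] := hP i iY; exact: diagram_mem dg iY.
have branch i j1 j2 j3 : (i < rank Y)%N ->
    all (fun j => [&& j < rank Y, j != i & cartan_matrix Y i j != 0])%N [:: j1; j2; j3] ->
    uniq [:: j1; j2; j3] -> f (centre X) \in K.
  move=> iY /and4P[/and3P[n1 i1 m1] /and3P[n2 i2 m2] /and3P[n3 i3 m3] _] uj.
  rewrite -(@three_neighbours_centre X (h i) (h j1) (h j2) (h j3)) //; first exact: gE.
  - exact: (hP i iY).1.
  - by rewrite /= -!hM // !hI // i1 i2 i3 m1 m2 m3 !andbT (hP j1 n1).1 (hP j2 n2).1 (hP j3 n3).1.
  - by move: uj; rewrite /= !inE !hI.
have bond i j : (i < rank Y)%N -> (j < rank Y)%N -> i != j ->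
    1 < cartan_matrix Y i j * cartan_matrix Y j i -> f (centre X) \in K.
  move=> iY jY ij; rewrite !hM //.
  case/(multiple_bond_centre vX (hP i iY).1 (hP j jY).1); first by rewrite hI.
    by move=> <-; exact: gE.
  by move=> <-; exact: gE.
case: Y vY {dg hI hM hP gE} branch bond => [n|n|n|n||] /= vY branch bond.
- by apply: (bond n.-2 n.-1); first [lia | entry].
- by apply: (bond n.-2 n.-1); first [lia | entry].
- apply: (branch (n - 3)%N (n - 4)%N n.-2 n.-1); rewrite /= ?inE; try lia.
  apply/and4P; split=> //; (apply/and3P; split; [lia|lia|]); rewrite /simply_laced /chain; repeat decide_if; lia.
- by apply: (branch 3 1 2 4)%N => //; rewrite /= ?andbT; lia.
- exact: (bond 1 2)%N.
- exact: (bond 0 1)%N.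
Qed.

End Subdiagrams.

(** * Uniqueness of subdiagrams *)

Fixpoint words n m : seq (seq nat) :=
  if m is m'.+1 then [seq i :: s | i <- iota 0 n, s <- words n m'] else [:: [::]].

Lemma mem_words n m s : size s = m -> all (gtn n) s -> s \in words n m.
Proof.
elim: m s => [|m IHm] [|i s] //= [sm] /andP[i_n sn].
by apply/allpairsP; exists (i, s); rewrite mem_iota IHm.
Qed.

Definition rigid_check n (M : nat -> nat -> int) m (M' : nat -> nat -> int) (t : seq nat) : bool :=
  all (fun s => all (fun i => all (fun j =>
    M' i j == M (nth 0 s i) (nth 0 s j)) (iota 0 m)) (iota 0 m) ==> (s == t))%N (words n m).

Lemma D_centre_neighbours n j : (4 <= n)%N -> (j < n)%N -> j != (n - 3)%N ->
  cartan_matrix (DynkinD n) (n - 3) j != 0 -> j = (n - 4)%N \/ j = n.-2 \/ j = n.-1.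
Proof.
move=> n4 jn j3 Mj; have [|j_not] := boolP [|| j == n - 4, j == n.-2 | j == n.-1]%N; first by lia.
by case/eqP: Mj; entry.
Qed.

Lemma D_centre_bonds n : (4 <= n)%N -> [/\ cartan_matrix (DynkinD n) (n - 3) (n - 4) != 0,
  cartan_matrix (DynkinD n) (n - 3) n.-2 != 0 & cartan_matrix (DynkinD n) (n - 3) n.-1 != 0].
Proof. by move=> n4; split; entry. Qed.

Section Uniqueness.
Variables (R : realFieldType) (V : vectType R) (Phi : root_system V).
Implicit Types (a b r u v : Phi) (I J K D S : {set Phi}) (f g : nat -> Phi).

Lemma rigid_subdiagram n M f D m M' g K t : diagram n M f D -> diagram m M' g K ->
  K \subset D -> rigid_check n M m M' t -> K = img f t.
Proof.
move=> df dg KD rigid; have [h [hP _ hM]] := sub_diagram_index df dg KD.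
have nth_h i : (i < m)%N -> nth 0%N (map h (iota 0 m)) i = h i.
  by move=> im; rewrite (nth_map 0%N) ?size_iota // nth_iota.
have /eqP <- : map h (iota 0 m) == t.
  have /(allP rigid)/implyP : map h (iota 0 m) \in words n m.
    apply: mem_words; first by rewrite size_map size_iota.
    by apply/allP => _ /mapP[i + ->]; rewrite mem_iota => /hP[].
  apply; apply/allP => i; rewrite mem_iota => im; apply/allP => j; rewrite mem_iota => jm.
  by rewrite !nth_h // hM.
have [_ -> _] := dg; apply/setP => x; rewrite !inE -map_comp.
by congr (_ \in _); apply/eq_in_map => i; rewrite mem_iota => /hP[_ ->].
Qed.

Lemma rigid_unique X Y f D K t : diagram (rank X) (cartan_matrix X) f D ->
  rigid_check (rank X) (cartan_matrix X) (rank Y) (cartan_matrix Y) t ->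
  (0 < rank Y)%N -> has_type Y K -> K \subset D -> is_unique_subdiagram D Y K.
Proof.
move=> df rigid rY tK KD; split=> //; first by apply/(of_typeP K rY).
move=> L LD /(of_typeP L rY)[h dh]; have [g dg] := tK.
by rewrite (rigid_subdiagram df dg KD rigid) (rigid_subdiagram df dh LD rigid).
Qed.

Lemma D_tail n f D k : diagram n (cartan_matrix (DynkinD n)) f D ->
  (4 <= k)%N -> (k <= n)%N -> has_type (DynkinD k) (img f (iota (n - k) k)).
Proof.
move=> df k4 kn.
have [||i j i_k j_k|dK _] := diagram_sub (m := k) (M' := cartan_matrix (DynkinD k))
  (t := fun i => (i + (n - k))%N) df.
- by move=> i; lia.
- by move=> i j _ _; lia.
- by entry.
exists (f \o addn^~ (n - k)%N); congr (diagram _ _ _ _): dK.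
rewrite img_map; congr img; rewrite -[in RHS](addn0 (n - k)%N) iotaDl.
by apply: eq_map => i; rewrite addnC.
Qed.

Lemma D_connected k g K : (4 <= k)%N -> diagram k (cartan_matrix (DynkinD k)) g K -> connected K.
Proof.
move=> k4 dg; have gK i : (i < k)%N -> g i \in K by exact: diagram_mem dg.
have cn : (k - 3 < k)%N by lia.
have adj i j : (i < k)%N -> (j < k)%N -> i != j -> cartan_matrix (DynkinD k) i j != 0 ->
    adjacent K (g i) (g j).
  move=> ik jk ij Mij; rewrite adjacentE !gK // (diagram_eq dg) // ij mult_gt0.
  by have [_ _ ->] := dg.
have chainE d : (d <= k - 3)%N -> connect (adjacent K) (g (k - 3)%N) (g (k - 3 - d)%N).
  elim: d => [|d IHd] dk; first by rewrite subn0.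
  apply: connect_trans (IHd (ltnW dk)) _; apply/connect1/adj; try lia.
  by entry.
have cE i : (i < k)%N -> connect (adjacent K) (g (k - 3)%N) (g i).
  move=> ik; have [i3|i3] := leqP i (k - 3)%N.
    by have := chainE (k - 3 - i)%N (leq_subr _ _); rewrite subKn.
  by apply/connect1/adj; rewrite ?ik //; [lia|entry].
split; first by apply/set0Pn; exists (g (k - 3)%N); exact: gK.
move=> _ _ /(diagram_index dg)[i ik ->] /(diagram_index dg)[j jk ->].
apply: connect_trans (cE j jk).
by rewrite (sym_connect_sym (@adjacent_sym _ _ _ _)) cE.
Qed.

Lemma D_subdiagram n f D k K : diagram n (cartan_matrix (DynkinD n)) f D ->
  (4 <= n)%N -> (4 <= k)%N -> has_type (DynkinD k) K -> K \subset D ->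
  (k <= n)%N /\ K = img f (iota (n - k) k).
Proof.
move=> df n4 k4 tK KD.
have [g dg] : exists g, diagram k (cartan_matrix (DynkinD k)) g K := tK.
have kn : (k <= n)%N.
  by rewrite -(diagram_card dg) -(diagram_card df) subset_leq_card.
split=> //.
have [_ conK] := D_connected k4 dg.
have cK := centre_mem (X := DynkinD n) (Y := DynkinD k) n4 k4 df tK KD.
have up i : (i < n - 3)%N -> f i \in K -> f i.+1 \in K.
  move=> i3 fiK; apply: contraT => fi1K.
  have clos : closed (adjacent K) (mem (img f (iota 0 i.+1))).
    apply: intro_closed; first exact: sym_connect_sym (@adjacent_sym _ _ _ _).
    move=> x y; rewrite adjacentE mult_gt0 => /and4P[xK yK xy nxy] /imgP[j].
    rewrite mem_iota => /andP[_ ji] xE.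
    have [l ln yE] := diagram_index df (subsetP KD y yK).
    apply/imgP; exists l => //; rewrite mem_iota.
    have li1 : l != i.+1 by apply: contraNneq fi1K => <-; rewrite -yE.
    have jn : (j < n)%N by lia.
    move: nxy; rewrite xE yE; have [_ _ ->] := df => //.
    have jl : j != l by rewrite -(diagram_eq df) // -xE -yE.
    clear - ji i3 ln li1 jl n4; move: ji; rewrite add0n ltnS => ji.
    by apply: contraR => lbig; apply/eqP; entry.
  have : f (n - 3)%N \in img f (iota 0 i.+1).
    have <- : (f i \in img f (iota 0 i.+1)) = (f (n - 3)%N \in img f (iota 0 i.+1)).
      by apply: (closed_connect clos); apply: conK.
    by rewrite mem_img // mem_iota add0n ltnS leqnn.
  move=> /imgP[j].
  rewrite mem_iota => /andP[_ ji] /eqP; rewrite (diagram_eq df); lia.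
have [h [hP hI hM]] := sub_diagram_index df dg KD.
have hK i : (i < k)%N -> f (h i) \in K by move=> ik; rewrite -(hP i ik).2 (diagram_mem dg).
have ck : (k - 3 < k)%N by lia.
have n1 : (k - 4 < k)%N by lia.
have n2 : (k.-2 < k)%N by lia.
have n3 : (k.-1 < k)%N by lia.
have [m1 m2 m3] := D_centre_bonds k4.
have e1 : h (k - 4)%N != h (k - 3)%N by rewrite hI //; clear - k4; lia.
have e2 : h k.-2 != h (k - 3)%N by rewrite hI //; clear - k4; lia.
have e3 : h k.-1 != h (k - 3)%N by rewrite hI //; clear - k4; lia.
have e12 : h (k - 4)%N != h k.-2 by rewrite hI //; clear - k4; lia.
have e13 : h (k - 4)%N != h k.-1 by rewrite hI //; clear - k4; lia.
have e23 : h k.-2 != h k.-1 by rewrite hI //; clear - k4; lia.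
rewrite !hM // in m1 m2 m3.
have hc : h (k - 3)%N = (n - 3)%N.
  apply: (@three_neighbours_centre (DynkinD n) _ (h (k - 4)%N) (h k.-2) (h k.-1)) => //.
  - exact: (hP _ ck).1.
  - by rewrite /= e1 e2 e3 m1 m2 m3 (hP _ n1).1 (hP _ n2).1 (hP _ n3).1.
  - by rewrite /= !inE negb_or e12 e13 e23.
have leaves i : i \in [:: n - 4; n.-2; n.-1]%N -> f i \in K.
  have := hK _ n1; have := hK _ n2; have := hK _ n3.
  rewrite hc in m1 m2 m3 e1 e2 e3.
  move: e12 e13 e23.
  move: (D_centre_neighbours n4 (hP _ n1).1 e1 m1) (D_centre_neighbours n4 (hP _ n2).1 e2 m2)
    (D_centre_neighbours n4 (hP _ n3).1 e3 m3).
  by case=> [->|[->|->]]; case=> [->|[->|->]]; case=> [->|[->|->]]; rewrite ?eqxx // => _ _ _;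
    move=> ? ? ?; rewrite !inE => /or3P[] /eqP->.
have exK : exists i, (i < n)%N && (f i \in K).
  by exists (n - 3)%N; rewrite cK andbT; clear - n4; lia.
case: (ex_minnP exK) => l /andP[ln lK] lmin.
have l4 : (l <= n - 4)%N.
  by apply: lmin; rewrite leaves ?mem_head // andbT; clear - n4; lia.
have upK d : (l + d <= n - 3)%N -> f (l + d)%N \in K.
  elim: d => [|d IHd] dn; first by rewrite addn0.
  by rewrite addnS; apply: up; [clear - dn; lia|apply: IHd; clear - dn; lia].
have KE : K = img f (iota l (n - l)).
  apply/setP => x; apply/idP/imgP => [xK|[i + ->]].
    have [i i_n xE] := diagram_index df (subsetP KD x xK); exists i => //.
    have := lmin i; rewrite i_n -xE xK => /(_ isT) li.
    by rewrite mem_iota; clear - li i_n; lia.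
  rewrite mem_iota => il.
  have [i3|i3] := leqP i (n - 3)%N.
    by have := upK (i - l)%N; rewrite subnKC; [apply|]; clear - il i3; lia.
  by apply: leaves; rewrite !inE; clear - il i3 n4; lia.
have cardK := diagram_card dg.
rewrite KE cardsE (card_uniqP (diagram_uniq_iota l df)) size_map size_iota in cardK.
by rewrite KE; congr (img f (iota _ _)); clear - cardK ln kn; lia.
Qed.

Lemma D_unique n f D k K : diagram n (cartan_matrix (DynkinD n)) f D ->
  (4 <= n)%N -> (4 <= k)%N -> has_type (DynkinD k) K -> K \subset D ->
  is_unique_subdiagram D (DynkinD k) K.
Proof.
move=> df n4 k4 tK KD; have rk : (0 < rank (DynkinD k))%N by rewrite /=; lia.
split=> //; first by apply/(of_typeP K rk).
move=> L LD /(of_typeP L rk) tL.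
by rewrite (D_subdiagram df n4 k4 tK KD).2 (D_subdiagram df n4 k4 tL LD).2.
Qed.

(* An automorphism preserves every D_k tail, hence fixes the vertices outside D_4. *)
Lemma D_moved n f D k K : diagram n (cartan_matrix (DynkinD n)) f D ->
  (4 <= n)%N -> (4 <= k)%N -> has_type (DynkinD k) K -> K \subset D ->
  moved_vertices D \subset K.
Proof.
move=> df n4 k4 tK KD; have [kn ->] := D_subdiagram df n4 k4 tK KD.
apply/subsetP => a; rewrite inE => /andP[aD /exists_inP[s]].
rewrite inE => /andP[sD /forall_inP sM] sa.
have sMM x y : x \in D -> y \in D -> cartan (s x) (s y) = cartan x y.
  by move=> xD yD; apply/eqP; have /forall_inP := sM x xD; apply.
have [j jn aE] := diagram_index df aD.
have tailD l : img f (iota (n - l) l) \subset D \/ (n < l)%N.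
  case: (leqP l n) => ln; [left|by right].
  apply/subsetP => _ /imgP[i + ->]; rewrite mem_iota => il.
  by apply: (diagram_mem df); lia.
have tail l : (4 <= l)%N -> (l <= n)%N -> s @: img f (iota (n - l) l) = img f (iota (n - l) l).
  move=> l4 ln; have [lD|] := tailD l; last by lia.
  have [g [ginj gE gM]] := D_tail df l4 ln.
  have slD : s @: img f (iota (n - l) l) \subset D.
    by apply/subsetP => _ /imsetP[x xl ->]; rewrite (perm_closed _ sD) (subsetP lD).
  have dl : has_type (DynkinD l) (s @: img f (iota (n - l) l)).
    exists (s \o g); split.
    - by move=> p q pl ql /= /perm_inj; exact: ginj.
    - rewrite gE; apply/setP => x; apply/imsetP/imgP => [[_ /imgP[p pl ->] ->]|[p pl ->]].
        by exists p.
      by exists (g p) => //; rewrite mem_img.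
    - move=> p q pl ql; rewrite -gM //= sMM //; apply: (subsetP lD);
      by rewrite gE mem_img // mem_iota.
  exact: (D_subdiagram df n4 l4 dl slD).2.
apply: contraR sa => aK; have jk : (j < n - k)%N.
  by rewrite ltnNge; apply: contra aK => jk; rewrite aE mem_img // mem_iota; lia.
have jn4 : (4 <= n - j.+1)%N by lia.
have iE : iota (n - (n - j)) (n - j) = j :: iota (n - (n - j.+1)) (n - j.+1).
  by rewrite (subKn (ltnW jn)) (subKn jn) (iota_cons jn).
have : s a \in img f (iota (n - (n - j)) (n - j)).
  rewrite -tail; [|lia|lia]; rewrite imset_f // iE aE mem_img // mem_head //.
rewrite iE img_cons => /setU1P[->|]; first by rewrite aE.
rewrite -tail //; last by lia.
rewrite mem_imset; last exact: perm_inj.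
move=> /imgP[i]; rewrite mem_iota aE => il /eqP; rewrite (diagram_eq df) //; lia.
Qed.

End Uniqueness.

(** * Components and the theorem *)

Section Components.
Variables (R : realFieldType) (V : vectType R) (Phi : root_system V).
Implicit Types (a b r u v : Phi) (I J K D S : {set Phi}) (f g : nat -> Phi).

Lemma component_sub I a : component I a \subset I.
Proof. by apply/subsetP => x; rewrite inE => /andP[]. Qed.

Lemma mem_component I a : a \in I -> a \in component I a.
Proof. by move=> aI; rewrite inE aI connect0. Qed.

Lemma component_orth I a x b : x \in component I a -> b \in I ->
  b \notin component I a -> cartan x b = 0.
Proof.
rewrite !inE => /andP[xI ax] bI; rewrite bI /= => ab; apply/eqP/negPn/negP => xb.
have xb' : x != b by apply: contraNneq ab => <-.
case/negP: ab; apply: connect_trans ax _; apply: connect1.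
by rewrite adjacentE xI bI xb' mult_gt0.
Qed.

Lemma component_connected I a : a \in I -> connected (component I a).
Proof.
move=> aI; have cE b : connect (adjacent I) a b -> connect (adjacent (component I a)) a b.
  case/connectP=> p + ->; elim/last_ind: p => [//|p c IHp].
  rewrite rcons_path last_rcons => /andP[/[dup] pp /IHp ca lc].
  apply: connect_trans ca (connect1 _); move: (lc); rewrite !adjacentE => /and4P[lI cI -> ->].
  have al : connect (adjacent I) a (last a p) by apply/connectP; exists p.
  by rewrite !inE lI cI al !andbT /=; exact: connect_trans al (connect1 lc).
split; first by apply/set0Pn; exists a; exact: mem_component.
move=> x y; rewrite !inE => /andP[_ /cE ax] /andP[_ /cE ay]; apply: connect_trans ay.
by rewrite (sym_connect_sym (@adjacent_sym _ _ _ _)).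
Qed.

Lemma component_eq I a b c : c \in component I a -> c \in component I b ->
  component I a = component I b.
Proof.
rewrite !inE => /andP[_ ac] /andP[_ bc]; apply/setP => x; rewrite !inE; congr (_ && _).
have csym : connect_sym (adjacent I) := sym_connect_sym (@adjacent_sym _ _ _ _).
by rewrite (same_connect csym ac) (same_connect csym bc).
Qed.

Lemma nonisolated_sub I : nonisolated I \subset I.
Proof. by apply/bigcupsP => a _; exact: component_sub. Qed.

Lemma isolated_orth I a b : a \in I -> b \in I -> b \notin nonisolated I -> a != b ->
  cartan a b = 0.
Proof.
move=> aI bI bN ab; apply/eqP/negPn/negP; rewrite cartan_eq0 => nab.
case/negP: bN; apply/bigcupP; exists b; last exact: mem_component.
rewrite bI /=; apply: (@leq_trans #|[set a; b]|); first by rewrite cards2 ab.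
apply/subset_leq_card; rewrite subUset !sub1set mem_component // andbT inE aI.
by apply: connect1; rewrite adjacentE aI bI eq_sym ab mult_gt0.
Qed.

Lemma has_neg_nonisolated I : has_neg (nonisolated I) -> has_neg I.
Proof.
move=> nN; suff H m J : (#|J| <= m)%N -> J \subset I :\: nonisolated I ->
    has_neg (J :|: nonisolated I).
  rewrite -(setID I (nonisolated I)) (setIidPr (nonisolated_sub I)) setUC.
  exact: H (leqnn _) (subxx _).
elim: m J => [|m IHm] J cJ JI.
  by move: cJ; rewrite leqn0 cards_eq0 => /eqP ->; rewrite set0U.
have [->|/set0Pn[b bJ]] := eqVneq J set0; first by rewrite set0U.
have /setDP[bI bN] := subsetP JI b bJ.
rewrite -(setD1K bJ) -setUA; apply: has_neg_isolated.
- apply: IHm; last exact: subset_trans (subD1set _ _) JI.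
  by move: cJ; rewrite (cardsD1 b) bJ.
- by rewrite !inE eqxx (negPf bN).
- move=> a; rewrite in_setU in_setD1 => aJN.
  have [aI ab] : a \in I /\ a != b.
    case/orP: aJN => [/andP[-> /(subsetP JI)/setDP[] //]|aN].
    by split; [exact: subsetP (nonisolated_sub I) a aN|apply: contraNneq bN => <-].
  exact: isolated_orth aI bI bN ab.
Qed.

Lemma has_neg_type Y K : valid Y \/ Y = DynkinC 2 -> neg_type Y -> has_type Y K -> has_neg K.
Proof.
case: Y => [n|n|n|n||] /= vY nY [f df].
- apply: (has_neg_chain (p := 2) (q := 1)) => //; apply: (diagram_eqM df) => i j _ _.
  by rewrite chain_matrixB.
- apply: (has_neg_chain (p := 1) (q := 2)) => //; apply: (diagram_eqM df) => i j _ _.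
  by rewrite chain_matrixC.
- by case: vY => // n4; exact: has_neg_D df n4 nY.
- case: vY => // /andP[n6 n8].
  have [n_7|n_8] : n = 7%N \/ n = 8%N by lia.
    by subst n; exact: has_neg_E7 df.
  by subst n; exact: has_neg_E8 df.
- exact: has_neg_F4 df.
- exact: has_neg_G2 df.
Qed.

Lemma neg_component D I a : is_base D -> I \subset D -> has_neg I -> a \in I ->
  (2 <= #|component I a|)%N ->
  exists Y, [/\ valid Y, neg_type Y & has_type Y (component I a)].
Proof.
move=> baseD ID nI aI ge2; have KI := component_sub I a.
have Kiso x b : x \in component I a -> b \in I -> b \notin component I a -> cartan x b = 0.
  exact: component_orth.
have weight n M f y N := @not_has_neg_weight _ _ _ D I (component I a) n M f y N baseD ID nI ^~ KI.
have [[n [f df]]|[Y vY tY]] := classification baseD (subset_trans KI ID) (component_connected aI).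
  have n2 : (2 <= n)%N by rewrite -(diagram_card df).
  have := weight _ _ _ _ _ df Kiso (fun j jn => chainA_weight n2 jn) 0%N (ltnW n2).
  by move=> /(@dvdn_leq n.+1 2 isT); rewrite ltnS leqNgt n2.
exists Y; split=> //; move: tY; case: Y vY => [n|n|n|n||] //= vY [f df].
- have n1 : (n.-1 < n)%N by lia.
  have := weight _ _ _ _ _ df Kiso (fun j jn => spin_weightP vY jn) n.-1 n1.
  by rewrite /spin_weight eqxx => /dvdzP[q]; lia.
- apply/eqP => n_6; subst n.
  by have := weight _ _ _ _ _ df Kiso (fun j jn => E6_weightP jn) 0%N isT.
Qed.

Lemma nonisolated_connected D I : is_base D -> connected D -> I \subset D -> has_neg I ->
  nonisolated I != set0 ->
  exists Y X, [/\ valid Y, neg_type Y, has_type Y (nonisolated I), connected (nonisolated I) &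
    [/\ valid X, reach Y X & has_type X D]].
Proof.
move=> baseD conD ID nI /set0Pn[b /bigcupP[a /andP[aI a2] _]].
have [Y [vY nY tY]] := neg_component baseD ID nI aI a2.
have conK := component_connected aI.
have KD := subset_trans (component_sub I a) ID.
have [X [vX rX tX]] := grow baseD vY tY conK KD conD (subxx D).
have [f df] := tX.
suff NE : nonisolated I = component I a by exists Y, X; rewrite NE.
apply/eqP; rewrite eqEsubset; apply/andP; split; last first.
  by apply: (bigcup_sup a); rewrite aI.
apply/bigcupsP => c /andP[cI c2].
have [Z [vZ nZ tZ]] := neg_component baseD ID nI cI c2.
have cK := centre_mem vX vY df tY KD.
have cL := centre_mem vX vZ df tZ (subset_trans (component_sub I c) ID).
by rewrite (component_eq cL cK).
Qed.

End Components.

Section Cases.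
Variables (R : realFieldType) (V : vectType R) (Phi : root_system V).
Implicit Types (K D I : {set Phi}) (f g : nat -> Phi).

Lemma has_type_B2 K : has_type (DynkinB 2) K -> has_type (DynkinC 2) K.
Proof.
by case=> f df; exists (f \o nth 0%N [:: 1; 0]%N); apply: (diagram_relabel_seq df).
Qed.

Lemma chain_multilaced p q n m f g D K : (p * q = 2)%N -> (2 <= m)%N ->
  diagram n (chain_matrix p q n) f D -> diagram m (chain_matrix p q m) g K -> K \subset D ->
  multilaced D \subset K.
Proof.
move=> pq m2 df dg KD; have [h [hP hI hM]] := sub_diagram_index df dg KD.
have m1 : (m.-1 < m)%N by lia.
have m1' : (m.-2 < m)%N by lia.
have bond : 1 < chain_matrix p q m m.-2 m.-1 * chain_matrix p q m m.-1 m.-2.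
  by clear - m2 pq; case: (prod_eq2 pq) => [][-> ->]; entry.
have h12 : h m.-2 != h m.-1 by rewrite hI //; clear - m2; lia.
rewrite !hM // in bond.
have hbond := chain_multiple_bond (hP _ m1').1 (hP _ m1).1 h12 bond.
apply/subsetP => a; rewrite inE => /andP[aD /exists_inP[b bD /andP[ab mab]]].
have [i i_n aE] := diagram_index df aD; have [j j_n bE] := diagram_index df bD.
have ij : i != j by rewrite -(diagram_eq df) // -aE -bE.
move: mab; rewrite aE bE; have [_ _ fM] := df; rewrite !fM // => mab.
have ibond := chain_multiple_bond i_n j_n ij mab.
have [->|->] : i = h m.-2 \/ i = h m.-1 by clear - hbond ibond; lia.
  by rewrite -(hP _ m1').2 (diagram_mem dg).
by rewrite -(hP _ m1).2 (diagram_mem dg).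
Qed.

Lemma type_multilaced X Y D K : valid X -> valid Y \/ Y = DynkinC 2 ->
  (exists n m, X = DynkinB n /\ Y = DynkinB m \/ X = DynkinC n /\ Y = DynkinC m) ->
  has_type X D -> has_type Y K -> K \subset D -> multilaced D \subset K.
Proof.
move=> vX vY [n [m XY]] [f df] [g dg] KD.
have m2 : (2 <= m)%N.
  by case: XY vY => [][_ ->] [] //=; [exact: ltnW|case=> ->].
case: XY df dg => [][-> ->] /= df dg.
- apply: (chain_multilaced (p := 2) (q := 1) (erefl : (2 * 1 = 2)%N) m2) KD.
    by apply: (diagram_eqM df) => i j _ _; rewrite chain_matrixB.
  by apply: (diagram_eqM dg) => i j _ _; rewrite chain_matrixB.
- apply: (chain_multilaced (p := 1) (q := 2) (erefl : (1 * 2 = 2)%N) m2) KD.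
    by apply: (diagram_eqM df) => i j _ _; rewrite chain_matrixC.
  by apply: (diagram_eqM dg) => i j _ _; rewrite chain_matrixC.
Qed.

Lemma same_rank X f D K : diagram (rank X) (cartan_matrix X) f D ->
  has_type X K -> K \subset D -> D = K.
Proof.
move=> df [g dg] KD; apply/esym/eqP.
by rewrite eqEcard KD (diagram_card df) (diagram_card dg) leqnn.
Qed.

End Cases.

Theorem theoremA3p1 (R : realFieldType) (V : vectType R) (Phi : root_system V)
    (D I : {set Phi}) (s : {perm Phi})
    (triple_DIs : dynkin_triple D I s) (conn_D : connected D) (s1 : s = 1%g)
    (I_ge2 : nonisolated I != set0) :
  {in I, forall a, s a = opposition I a} <->
  (* B_n and C_n *)
  ((exists n m : nat,
      [/\ (2 <= n)%N, (2 <= m <= n)%N,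
          (of_type (DynkinB n) D /\ of_type (DynkinB m) (nonisolated I)) \/
          (of_type (DynkinC n) D /\ of_type (DynkinC m) (nonisolated I)) &
          connected (nonisolated I) /\ multilaced D \subset nonisolated I]) \/
  (* D_4 and G_2 *)
   (of_type (DynkinD 4) D \/ of_type DynkinG2 D) /\ D = nonisolated I \/
  (* D_n for n >= 5 *)
   (exists n m : nat,
      [/\ (5 <= n)%N, (2 <= m)%N /\ (m.*2 <= n)%N, of_type (DynkinD n) D,
          is_unique_subdiagram D (DynkinD m.*2) (nonisolated I) &
          [/\ connected (nonisolated I), ~~ odd #|nonisolated I| &
              moved_vertices D \subset nonisolated I]]) \/
  (* F_4 *)
   of_type DynkinF4 D /\
     (is_unique_subdiagram D (DynkinB 2) (nonisolated I) \/
      is_unique_subdiagram D (DynkinB 3) (nonisolated I) \/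
      is_unique_subdiagram D (DynkinC 3) (nonisolated I) \/
      is_unique_subdiagram D DynkinF4 (nonisolated I)) \/
  (* E_6, E_7 and E_8 *)
   of_type (DynkinE 6) D /\ of_type (DynkinD 4) (nonisolated I) \/
   of_type (DynkinE 7) D /\
     (of_type (DynkinD 4) (nonisolated I) \/
      of_type (DynkinD 6) (nonisolated I) \/
      of_type (DynkinE 7) (nonisolated I)) \/
   of_type (DynkinE 8) D /\
     (of_type (DynkinD 4) (nonisolated I) \/
      of_type (DynkinD 6) (nonisolated I) \/
      of_type (DynkinE 7) (nonisolated I) \/
      of_type (DynkinE 8) (nonisolated I))).
Proof.
have [baseD ID _ _] := triple_DIs.
have -> : {in I, forall a, s a = opposition I a} <-> has_neg I.
  rewrite -(opposition_trivial baseD ID) s1.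
  by split=> opp a /opp; rewrite perm1.
have neg Y : valid Y \/ Y = DynkinC 2 -> neg_type Y -> of_type Y (nonisolated I) -> has_neg I.
  move=> vY nY oY; apply: has_neg_nonisolated; apply: (has_neg_type vY nY).
  by apply: (of_typeP _ _).1 oY; case: vY => [/rank_gt0|->].
split.
  move=> nI; have [Y [X [vY nY tY conK [vX rX tX]]]] := nonisolated_connected baseD conn_D ID nI I_ge2.
  have KD := subset_trans (nonisolated_sub I) ID.
  have [f df] := tX.
  have oX : of_type X D := (of_typeP D (rank_gt0 vX)).2 tX.
  have oY := (of_typeP (nonisolated I) (rank_gt0 vY)).2 tY.
  have multi Y' : valid Y' \/ Y' = DynkinC 2 -> has_type Y' (nonisolated I) ->
      (exists n m, X = DynkinB n /\ Y' = DynkinB m \/ X = DynkinC n /\ Y' = DynkinC m) ->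
      multilaced D \subset nonisolated I.
    by move=> vY' tY' XY; exact: type_multilaced vX vY' XY tX tY' KD.
  case: Y vY nY tY oY rX multi => [m|m|m|m||] vY nY tY oY; case: X vX df tX oX => [n|n|n|n||] vX df tX oX;
    move: vY nY vX => //= vY nY vX mn multi.
  - left; exists n, m; split=> //; first exact/andP.
      by left.
    by split=> //; apply: (multi (DynkinB m)); [left| |exists n, m; left].
  - move/eqP: mn => mn; subst m; left; exists n, 2%N; split=> //; first exact: ltnW vX.
    + exact: ltnW vX.
    + by right; split=> //; apply: (of_typeP _ _).2 => //; exact: has_type_B2.
    + split=> //; apply: (multi (DynkinC 2)); [by right|exact: has_type_B2|by exists n, 2%N; right].
  - do 3 right; left; split=> //; have [m_2|m_3] : m = 2%N \/ m = 3%N by clear - vY mn; lia.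
      subst m; left.
      by apply: (rigid_unique (t := [:: 1; 2]%N) df) => //; vm_compute.
    subst m; right; left.
    by apply: (rigid_unique (t := [:: 0; 1; 2]%N) df) => //; vm_compute.
  - left; exists n, m; split=> //; [exact: ltnW vX|by apply/andP; split=> //; exact: ltnW vY|by right|].
    by split=> //; apply: (multi (DynkinC m)); [left| |exists n, m; right].
  - move/eqP: mn => mn; subst m; do 3 right; left; split=> //; right; right; left.
    by apply: (rigid_unique (t := [:: 3; 2; 1]%N) df) => //; vm_compute.
  - have [n_4|n_4] := eqVneq n 4%N.
      subst n; have m_4 : m = 4%N by apply/eqP; rewrite eqn_leq mn.
      subst m; right; left; split; first by left.
      exact: same_rank df tY KD.
    do 2 right; left; exists n, m./2; rewrite (even_halfK nY).
    have [g dg] := tY; split=> //.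
    + by clear - vX n_4; lia.
    + by split=> //; clear - vY; lia.
    + exact: D_unique df vX vY tY KD.
    + split=> //; first by rewrite (diagram_card dg).
      exact: D_moved df vX vY tY KD.
  - have [n_6|[n_7|n_8]] : n = 6%N \/ n = 7%N \/ n = 8%N by clear - vX; lia.
    + have m_4 : m = 4%N by clear - n_6 vY nY mn; lia.
      by subst; do 4 right; left.
    + have [m_4|m_6] : m = 4%N \/ m = 6%N by clear - n_7 vY nY mn; lia.
        by subst; do 5 right; left; split=> //; left.
      by subst; do 5 right; left; split=> //; right; left.
    + have [m_4|m_6] : m = 4%N \/ m = 6%N by clear - n_8 vY nY mn; lia.
        by subst; do 6 right; split=> //; left.
      by subst; do 6 right; split=> //; right; left.
  - have [m_7|m_8] : m = 7%N \/ m = 8%N by clear - vY nY; lia.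
      have [n_7|n_8] : n = 7%N \/ n = 8%N by clear - vX m_7 mn; lia.
        by subst; do 5 right; left; split=> //; do 2 right.
      by subst; do 6 right; split=> //; do 2 right; left.
    have n_8 : n = 8%N by clear - vX m_8 mn; lia.
    by subst; do 6 right; split=> //; do 3 right.
  - do 3 right; left; split=> //; do 3 right.
    by apply: (rigid_unique (t := [:: 0; 1; 2; 3]%N) df) => //; vm_compute.
  - right; left; split; first by right.
    exact: same_rank df tY KD.
case=> [[n [m [_ /andP[m2 _] oY _]]]|[[oD DK]|[[n [m [_ [m2 _] _ [_ oY _] _]]]|[[_ oY]|[[_ oY]|[[_ oY]|[_ oY]]]]]]].
- case: oY => [][_ oY]; first exact: (neg (DynkinB m) (or_introl m2) isT oY).
  have [m_2|m_2] := eqVneq m 2%N; first by subst m; exact: (neg (DynkinC 2) (or_intror erefl) isT oY).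
  by apply: (neg (DynkinC m)) => //; left; rewrite /= ltn_neqAle eq_sym m_2.
- by rewrite DK in oD; case: oD => oY; apply: (neg _ _ _ oY) => //; left.
- by apply: (neg _ _ _ oY); [left; rewrite /=; lia|rewrite /= odd_double].
- by case: oY => [[_ oY _]|[[_ oY _]|[[_ oY _]|[_ oY _]]]]; apply: (neg _ _ _ oY) => //; left.
- by apply: (neg _ _ _ oY) => //; left.
- by case: oY => [|[]] oY; apply: (neg _ _ _ oY) => //; left.
- by case: oY => [|[|[]]] oY; apply: (neg _ _ _ oY) => //; left.
Qed.
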